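(* Let $N\ge 0$ be an integer (the cut-off $N_{cut}$) and let $H_N^{(0)}$ be the cut Hamiltonian in the bosonic ($n_F=0$) gauge-invariant sector of the $SU(3)$ model. For integers $\kappa\ge0$ put $d_\kappa=\lfloor\frac12(N-6\kappa)\rfloor+1$ and $d'_\kappa=\lfloor\frac12(N-6\kappa-3)\rfloor+1$. (i) For every integer $\kappa$ with $0\le\kappa\le\lfloor N/6\rfloor$ and every root $2E_m$ ($1\le m\le d_\kappa$) of the polynomial $L^{6\kappa+3}_{d_\kappa}$, the vector $$|E_m,\kappa\rangle_{even}=(2E_m)^{3\kappa}e^{-E_m}\sum_{n=0}^{d_\kappa-1}L_n^{6\kappa+3}(2E_m)\Big(|n,2\kappa\rangle+\sum_{t=1}^{\kappa}\Gamma^{even}_{\kappa-1,\kappa-t}\,|n+3t,2\kappa-2t\rangle\Big)$$ is an eigenvector of $H_N^{(0)}$ with eigenvalue $E_m$, where $\Gamma^{even}_{\kappa-1,t}=(-24)^{t-\kappa}\frac{(\kappa+t)!}{(\kappa-t)!\,(2t)!}$. (ii) For every integer $\kappa$ with $0\le\kappa\le\lfloor (N-3)/6\rfloor$ and every root $2E_m$ ($1\le m\le d'_\kappa$) of the polynomial $L^{6\kappa+6}_{d'_\kappa}$, the vector $$|E_m,\kappa\rangle_{odd}=(2E_m)^{3\kappa+\frac32}e^{-E_m}\sum_{n=0}^{d'_\kappa-1}L_n^{6\kappa+6}(2E_m)\Big(|n,2\kappa+1\rangle+\sum_{t=1}^{\kappa}\Gamma^{odd}_{\kappa-1,\kappa-t}\,|n+3t,2\kappa-2t+1\rangle\Big)$$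 is an eigenvector of $H_N^{(0)}$ with eigenvalue $E_m$, where $\Gamma^{odd}_{\kappa-1,t}=(-24)^{t-\kappa}\frac{(\kappa+t+1)!}{(\kappa-t)!\,(2t+1)!}$. (iii) The vectors in (i) and (ii), over all admissible $\kappa$ and $m$, are the complete set of solutions: they form a basis of the cut bosonic space $V_N^{(0)}$.
   Context: Model. Let $A=1,\dots,8$ label the generators $T^A$ of $SU(3)$ in the fundamental representation, normalized by $\mathrm{tr}(T^AT^B)=\frac12\delta_{AB}$. Bosonic operators satisfy $[a_A,a_B^\dagger]=\delta_{AB}$, $[a_A,a_B]=0$, and $|0\rangle$ is the Fock vacuum ($a_A|0\rangle=0$). Put $a=\sum_A a_AT^A$, $a^\dagger=\sum_A a_A^\dagger T^A$ (operator-valued $3\times3$ matrices), and write $(O)$ for the trace $\mathrm{tr}(O)$ of a product of such matrices; thus $(a^\dagger a^\dagger)=\frac12\sum_A a_A^\dagger a_A^\dagger$. The Hamiltonian is $$H=(a^\dagger a)+2-\tfrac12(a^\dagger a^\dagger)-\tfrac12(aa).$$ Basis. $|j,k\rangle=(a^\dagger a^\dagger)^j(a^\dagger a^\dagger a^\dagger)^k|0\rangle$ for integers $j,k\ge0$. It is known (and taken as given) that the $|j,k\rangle$ with $2j+3k\le N$ form a basis (not orthogonal) of the space $V_N^{(0)}$ of $SU(3)$-invariant states with no fermion and at most $N$ bosonic quanta. Cut Hamiltonian. $H_N^{(0)}=P_NH|_{V_N^{(0)}}$, where $P_N$ is the projection discarding all components with more than $N$ bosonic quanta. Equivalently, $\sum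 a_{j,k}|j,k\rangle\in V_N^{(0)}$ satisfies $H_N^{(0)}|E\rangle=E|E\rangle$ iff for all $j,k\ge0$ with $2j+3k\le N$, $$a_{j-1,k}-(2j+3k+4-2E)a_{j,k}+(j+1)(j+3k+4)a_{j+1,k}+\tfrac38(k+1)(k+2)a_{j-2,k+2}=0,$$ where $a_{j,k}=0$ if $j<0$, $k<0$ or $2j+3k>N$. Rescaled Laguerre (Sonine) polynomials. $L_n^\alpha(x)=\mathcal L_n^\alpha(x)/\Gamma(n+\alpha+1)$ with $\mathcal L_n^\alpha$ the standard generalized Laguerre polynomial, i.e. $L_n^\alpha(x)=\sum_{i=0}^n\frac{(-x)^i}{i!\,(n-i)!\,\Gamma(\alpha+i+1)}$. *)

(* Defs.v *)
From HB Require Import structures.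
From mathcomp Require Import all_boot all_order all_algebra.
From mathcomp Require Import reals sequences exp.
From mathcomp Require Import complex polyrcf mpoly.

Set Implicit Arguments.
Unset Strict Implicit.
Unset Printing Implicit Defensive.

Import Order.TTheory GRing.Theory Num.Theory.
Local Open Scope ring_scope.
Local Open Scope complex_scope.

(* Bargmann realization of the Fock space of eight bosons: the monomial
   \prod_A 'X_A ^+ (m A) stands for \prod_A (a_A^dagger) ^ (m A) |0>.  Hence
   a_A^dagger is multiplication by 'X_A, a_A is the partial derivative with
   respect to 'X_A, |0> is the constant 1, and the number of bosonic quanta is
   the degree. *)
Definition fock (R : rcfType) := {mpoly R[i][8]}.

Definition annih (R : rcfType) (A : 'I_8) (f : fock R) : fock R := f^`M(A).
Definition creat (R : rcfType) (A : 'I_8) (f : fock R) : fock R := 'X_A * f.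
Definition vac (R : rcfType) : fock R := 1.

Lemma annih_creat (R : rcfType) (A B : 'I_8) (f : fock R) :
  annih A (creat B f) - creat B (annih A f) = (A == B)%:R *: f.
Proof.
rewrite /annih /creat mderivM addrK mderivX mnmE eq_sym.
case: eqVneq => [->|_]; last by rewrite !scale0r mul0r.
by rewrite -[X in (X - _)%MM]add0m addmK mpolyX0 !scale1r mul1r.
Qed.

Lemma annih_comm (R : rcfType) (A B : 'I_8) (f : fock R) :
  annih A (annih B f) = annih B (annih A f).
Proof. exact: mderiv_comm. Qed.

Lemma annih_vac (R : rcfType) (A : 'I_8) : annih A (vac R) = 0.
Proof. by rewrite /annih /vac -mpolyC1 mderivC. Qed.

Definition adjmx (R : rcfType) (U : 'M[R[i]]_3) : 'M[R[i]]_3 :=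
  map_mx Num.conj U^T.

Definition su3_generators (R : rcfType) (T : 'I_8 -> 'M[R[i]]_3) : Prop :=
  [/\ forall A, adjmx (T A) = T A,
      forall A, \tr (T A) = 0
    & forall A B, \tr (T A *m T B) = (A == B)%:R / 2%:R].

Definition in_SU3 (R : rcfType) (U : 'M[R[i]]_3) : Prop :=
  U *m adjmx U = 1%:M /\ \det U = 1.

(* 3 x 3 matrices whose entries are operators on the Fock space. *)
Definition opmx (R : rcfType) := 'I_3 -> 'I_3 -> fock R -> fock R.

Definition opmul (R : rcfType) (M M' : opmx R) : opmx R :=
  fun i j f => \sum_k M i k (M' k j f).

Definition optr (R : rcfType) (M : opmx R) (f : fock R) : fock R :=
  \sum_i M i i f.

Definition amx (R : rcfType) (T : 'I_8 -> 'M[R[i]]_3) : opmx R :=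
  fun i j f => \sum_A T A i j *: annih A f.

Definition admx (R : rcfType) (T : 'I_8 -> 'M[R[i]]_3) : opmx R :=
  fun i j f => \sum_A T A i j *: creat A f.

Definition ham (R : rcfType) (T : 'I_8 -> 'M[R[i]]_3) (f : fock R) : fock R :=
  optr (opmul (admx T) (amx T)) f + 2%:R *: f
  - 2%:R^-1 *: optr (opmul (admx T) (admx T)) f
  - 2%:R^-1 *: optr (opmul (amx T) (amx T)) f.

(* |j,k> *)
Definition ket (R : rcfType) (T : 'I_8 -> 'M[R[i]]_3) (j k : nat) : fock R :=
  iter j (optr (opmul (admx T) (admx T)))
    (iter k (optr (opmul (opmul (admx T) (admx T)) (admx T))) (vac R)).

(* The gauge action of U: it fixes the vacuum and replaces a_B^dagger by
   \sum_A D_AB a_A^dagger, where U T^B U^dagger = \sum_A D_AB T^A, i.e.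
   D_AB = 2 tr (T^A U T^B U^dagger). *)
Definition gauge_act (R : rcfType) (T : 'I_8 -> 'M[R[i]]_3) (U : 'M[R[i]]_3)
    (f : fock R) : fock R :=
  f \mPo [tuple \sum_(A < 8)
            (2%:R * \tr (T A *m (U *m T B *m adjmx U))) *: 'X_A | B < 8].

(* V_N^(0) *)
Definition inv_space (R : rcfType) (T : 'I_8 -> 'M[R[i]]_3) (N : nat)
    (f : fock R) : Prop :=
  (msize f <= N.+1)%N /\ forall U, in_SU3 U -> gauge_act T U f = f.

(* P_N *)
Definition cut_proj (R : rcfType) (N : nat) (f : fock R) : fock R :=
  \sum_(m <- msupp f | (mdeg m <= N)%N) f@_m *: 'X_[m].

(* H_N^(0), to be applied to elements of V_N^(0) only *)
Definition cut_ham (R : rcfType) (T : 'I_8 -> 'M[R[i]]_3) (N : nat)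
    (f : fock R) : fock R := cut_proj N (ham T f).

Definition cut_eigenvector (R : rcfType) (T : 'I_8 -> 'M[R[i]]_3) (N : nat)
    (E : R) (v : fock R) : Prop :=
  [/\ inv_space T N v, v <> 0 & cut_ham T N v = E%:C *: v].

(* L_n^alpha for a natural number alpha, so that
   Gamma (alpha + i + 1) = (alpha + i)`!. *)
Definition sonine (R : rcfType) (alpha n : nat) : {poly R} :=
  \sum_(i < n.+1)
    ((-1) ^+ i / (i`! * (n - i)`! * (alpha + i)`!)%:R) *: 'X^i.

(* d_kappa and d'_kappa; they are used only when 6 * kappa <= N and
   6 * kappa + 3 <= N respectively, where the natural number subtraction is
   the exact one. *)
Definition d_even (N kappa : nat) : nat := ((N - 6 * kappa)./2.+1)%N.
Definition d_odd (N kappa : nat) : nat := ((N - 6 * kappa - 3)./2.+1)%N.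

(* Gamma^{even}_{kappa-1,t} and Gamma^{odd}_{kappa-1,t}, for t <= kappa: the
   argument is kappa itself, not the subscript kappa - 1. *)
Definition Gamma_even (R : rcfType) (kappa t : nat) : R :=
  (-24%:R) ^ (t%:Z - kappa%:Z) *
  ((kappa + t)`!%:R / ((kappa - t)`! * (2 * t)`!)%:R).

Definition Gamma_odd (R : rcfType) (kappa t : nat) : R :=
  (-24%:R) ^ (t%:Z - kappa%:Z) *
  ((kappa + t + 1)`!%:R / ((kappa - t)`! * (2 * t + 1)`!)%:R).

Definition ket_even (R : realType) (T : 'I_8 -> 'M[R[i]]_3) (N kappa : nat)
    (E : R) : fock R :=
  ((2%:R * E) ^+ (3 * kappa) * expR (- E))%:C *:
  \sum_(0 <= n < d_even N kappa)
    ((sonine R (6 * kappa + 3) n).[2%:R * E])%:C *: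
    (ket T n (2 * kappa)
     + \sum_(1 <= t < kappa.+1)
         (Gamma_even R kappa (kappa - t))%:C *:
         ket T (n + 3 * t) (2 * kappa - 2 * t)).

Definition ket_odd (R : realType) (T : 'I_8 -> 'M[R[i]]_3) (N kappa : nat)
    (E : R) : fock R :=
  ((2%:R * E) `^ ((3 * kappa)%:R + 3%:R / 2%:R) * expR (- E))%:C *:
  \sum_(0 <= n < d_odd N kappa)
    ((sonine R (6 * kappa + 6) n).[2%:R * E])%:C *:
    (ket T n (2 * kappa + 1)
     + \sum_(1 <= t < kappa.+1)
         (Gamma_odd R kappa (kappa - t))%:C *:
         ket T (n + 3 * t) (2 * kappa - 2 * t + 1)).

(* One vector for each admissible kappa and each root 2 E_m; rootsR lists the
   distinct real roots in increasing order. *)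
Definition even_states (R : realType) (T : 'I_8 -> 'M[R[i]]_3) (N : nat) :
    seq (fock R) :=
  [seq ket_even T N kappa (x / 2%:R)
  | kappa <- [seq kappa <- iota 0 N.+1 | (6 * kappa <= N)%N],
    x <- rootsR (sonine R (6 * kappa + 3) (d_even N kappa))].

Definition odd_states (R : realType) (T : 'I_8 -> 'M[R[i]]_3) (N : nat) :
    seq (fock R) :=
  [seq ket_odd T N kappa (x / 2%:R)
  | kappa <- [seq kappa <- iota 0 N.+1 | (6 * kappa + 3 <= N)%N],
    x <- rootsR (sonine R (6 * kappa + 6) (d_odd N kappa))].

(* The list s is a basis of the subspace W of a vector space that may be
   infinite-dimensional (so that vector.v does not apply). *)
Definition is_basis (K : fieldType) (V : lmodType K) (W : V -> Prop)
    (s : seq V) : Prop :=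
  [/\ forall v, v \in s -> W v,
      forall c : 'I_(size s) -> K,
        \sum_(i < size s) c i *: s`_i = 0 -> forall i, c i = 0
    & forall v, W v ->
        exists c : 'I_(size s) -> K, v = \sum_(i < size s) c i *: s`_i].

(* Main.v *)
From HB Require Import structures.
Require Import Defs.
From mathcomp Require Import all_boot all_order all_algebra all_fingroup all_field.
From mathcomp Require Import reals sequences exp.
From mathcomp Require Import complex polyrcf mpoly ring lra zify.

(* In the Bargmann realization an invariant state is a polynomial in p2 = tr X^2
   and p3 = tr X^3, where X = \sum_A 'X_A T^A (Chevalley restriction:
   diagonalize X by a special unitary matrix; what remains is a symmetric
   polynomial in the eigenvalues, whose sum is 0).  The operator (a a) is half
   the Laplacian.  For every k there is a harmonic polynomial h_k = p3^k + ...
   in p2, p3 of degree 3 k; the bracket in the even (odd) vector of index kappa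
   is p2^n h_k with k = 2 kappa (k = 2 kappa + 1).  On the span of the p2^n h_k,
   n >= 0, the Hamiltonian is a Jacobi matrix whose recurrence is the one of the
   Sonine polynomials with alpha = 3 k + 3, and the cut-off truncates this
   matrix; hence the eigenvalues are half the roots of the first Sonine
   polynomial beyond the cut.  These roots are real and simple by the
   Christoffel-Darboux identity, so evaluation at the roots is invertible, and
   the vectors form a basis because the p2^n h_k do, by triangularity in the
   powers of p3. *)

Set Implicit Arguments.
Unset Strict Implicit.
Unset Printing Implicit Defensive.

Import Order.TTheory GRing.Theory Num.Theory.
Local Open Scope ring_scope.

(** * Sonine polynomials *)

(** The Sonine parameter 3k + 3 is 8/2 - 1 plus the degree 3k of the harmonic factor, as for a
    radial oscillator in eight dimensions. The constant 24 comes from |grad p3|^2 = (3/4) p2^2, a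
    consequence of the completeness relation of the generators and of tr X^4 = (tr X^2)^2 / 2 for
    traceless X. With s^2 = p2^3 / 24 one has h_k = s^k U_k(p3 / (2s)), where U_k is the Chebyshev
    polynomial of the second kind. Unitary diagonalization needs a normal matrix, so polynomial
    identities are checked at points with natural coordinates, where X is Hermitian; in
    characteristic 0 these points suffice. The scalar prefactors are nonzero because 0 is never a
    root of a Sonine polynomial. Spanning is proved through induction principles for predicates
    closed under linear combinations, which avoids carrying coefficients along. *)

Lemma natr_fact_neq0 (K : numDomainType) (n : nat) : n`!%:R != 0 :> K.
Proof. by rewrite pnatr_eq0 -lt0n fact_gt0. Qed.

Section Sonine.
Variable R : rcfType.

(* [1 / (n - i)!], extended by [0] to [i > n] so that the recurrence below has
   no boundary cases. *)
Definition inv_fact_sub (n i : nat) : R :=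
  if (i <= n)%N then ((n - i)`!%:R)^-1 else 0.

Lemma inv_fact_subS (n i : nat) :
  (n.+1%:R - i%:R) * inv_fact_sub n.+1 i = inv_fact_sub n i.
Proof.
rewrite /inv_fact_sub; case: (ltngtP i n.+1) => [lt_in|lt_ni|->].
- rewrite ltnS in lt_in; rewrite lt_in subSn // factS natrM -natrB ?(leq_trans lt_in) //.
  rewrite subSn //.
  by rewrite invfM mulrA divff ?mul1r // pnatr_eq0.
- by rewrite leqNgt (leq_trans _ lt_ni) ?mulr0 // ltnW.
- by rewrite subrr mul0r ltnn.
Qed.

Lemma inv_fact_subSS (n i : nat) : inv_fact_sub n.+1 i.+1 = inv_fact_sub n i.
Proof. by rewrite /inv_fact_sub ltnS subSS. Qed.

Lemma coef_sonine (alpha n i : nat) :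
  (sonine R alpha n)`_i =
  (-1) ^+ i * (i`!%:R)^-1 * ((alpha + i)`!%:R)^-1 * inv_fact_sub n i.
Proof.
rewrite /sonine coef_sum /inv_fact_sub.
case: ifPn => [le_in|gt_in].
  have lt_in : (i < n.+1)%N by [].
  rewrite (bigD1 (Ordinal lt_in)) //= big1 ?addr0 => [|j /eqP ne_ji].
    by rewrite coefZ coefXn eqxx mulr1 !natrM !invfM; ring.
  rewrite coefZ coefXn; case: eqP => [e|_]; last by rewrite mulr0.
  by case: ne_ji; apply/val_inj.
rewrite mulr0 big1 // => j _; rewrite coefZ coefXn; case: eqP => [e|_].
  by move: gt_in; rewrite e -ltnS ltn_ord.
by rewrite mulr0.
Qed.

Lemma size_sonine (alpha n : nat) : size (sonine R alpha n) = n.+1.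
Proof.
apply/eqP; rewrite eqn_leq; apply/andP; split.
  apply/leq_sizeP => j lt_nj; rewrite coef_sonine /inv_fact_sub.
  by rewrite leqNgt lt_nj mulr0.
rewrite ltnNge; apply/negP => /leq_sizeP/(_ n (leqnn n)).
rewrite coef_sonine /inv_fact_sub leqnn subnn fact0 => /eqP.
by rewrite !mulf_eq0 !invr_eq0 signr_eq0 oner_eq0 !(negbTE (natr_fact_neq0 _ _)).
Qed.

Lemma sonine0 (alpha : nat) : sonine R alpha 0 = ((alpha`!%:R)^-1)%:P.
Proof.
apply/polyP=> i; rewrite coef_sonine coefC /inv_fact_sub.
case: i => [|i]; last by rewrite /= mulr0.
by rewrite addn0 /= expr0 fact0 invr1 mulr1 !mul1r.
Qed.

Lemma sonine_rec0 (alpha : nat) :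
  alpha.+1%:R *: sonine R alpha 1 = (alpha.+1%:R%:P - 'X) * sonine R alpha 0.
Proof.
apply/polyP => i; rewrite coefZ mulrBl coefB coefCM coefXM !coef_sonine.
have fz := natr_fact_neq0 R alpha.
have az : alpha.+1%:R != 0 :> R by rewrite pnatr_eq0.
rewrite /inv_fact_sub; case: i => [|[|i]] //=; rewrite ?mulr0 ?subr0 //.
rewrite addn0 addn1 !factS !fact0 natrM expr0 expr1; field.
by rewrite fz nat1r az.
Qed.

Lemma sonine_rec (alpha n : nat) :
  (n.+2 * (n + alpha).+2)%:R *: sonine R alpha n.+2 =
  ((n.*2 + alpha + 3)%:R%:P - 'X) * sonine R alpha n.+1 - sonine R alpha n.
Proof.
have e2 : (n + alpha).+2%:R = n%:R + alpha%:R + 2%:R :> R by rewrite -addn2 !natrD.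
have e1 (m : nat) : m.+1%:R = m%:R + 1 :> R by rewrite natr1.
have e3 : (n.*2 + alpha + 3)%:R = 2%:R * n%:R + alpha%:R + 3%:R :> R.
  by rewrite -muln2 !natrD natrM mulrC.
apply/polyP => i; rewrite coefZ coefB mulrBl coefB coefCM coefXM !coef_sonine.
rewrite natrM e2 e3.
case: i => [|i] /=.
  by rewrite -(inv_fact_subS n) -(inv_fact_subS n.+1) !e1 subr0; ring.
(* Every reciprocal factorial is now turned into a multiple of [inv_fact_sub n.+2 i.+1], which
   leaves a rational identity. *)
rewrite addnS !factS !natrM -(inv_fact_subSS n.+1 i).
rewrite -(inv_fact_subS n i.+1) -(inv_fact_subS n.+1 i.+1) exprS !e1.
have iz : i%:R + 1 != 0 :> R by rewrite natr1 pnatr_eq0.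
have az : (alpha + i)%:R + 1 != 0 :> R by rewrite natr1 pnatr_eq0.
have f1 := natr_fact_neq0 R i; have f2 := natr_fact_neq0 R (alpha + i).
rewrite natrD in az *.
move: (i`!%:R) f1 ((alpha + i)`!%:R) f2 (inv_fact_sub _ _) => x x0 y y0 z; field.
by rewrite x0 y0 iz az.
Qed.

End Sonine.

(** Induction on the three-term recurrence. The weights [w] are the factors that make the recurrence
    symmetric; for Sonine polynomials they are positive. *)
Lemma christoffel_darboux (K : fieldType) (u : nat -> {poly K}) (a b : nat -> K)
    (c y : K) (n : nat) (w := fun k => \prod_(i < k) b i) :
  u 0 = c%:P ->
  b 0 *: u 1 = ((a 0)%:P - 'X) * u 0 ->
  (forall k, b k.+1 *: u k.+2 = ((a k.+1)%:P - 'X) * u k.+1 - u k) ->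
  w n.+1 *: ((u n).[y] *: u n.+1 - (u n.+1).[y] *: u n) =
  (y%:P - 'X) * \sum_(k < n.+1) (w k * (u k).[y]) *: u k.
Proof.
move=> u0 rec0 recS.
have rec0y : b 0 * (u 1).[y] = (a 0 - y) * (u 0).[y].
  by rewrite -hornerZ rec0 !hornerE.
have recSy k : b k.+1 * (u k.+2).[y] = (a k.+1 - y) * (u k.+1).[y] - (u k).[y].
  by rewrite -hornerZ recS !hornerE.
have wS k : w k.+1 = w k * b k by rewrite /w big_ord_recr.
have w0 : w 0 = 1 by rewrite /w big_ord0.
elim: n => [|n IHn].
  rewrite big_ord1 /= wS w0 !mul1r scalerBr !scalerA [b 0 * (u 0).[y]]mulrC.
  rewrite -[((u 0).[y] * _) *: _]scalerA rec0 rec0y u0 hornerC.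
  by rewrite -!mul_polyC !polyCM !polyCB; ring.
rewrite big_ord_recr mulrDr /= -IHn {IHn} (wS n.+1); set W := w n.+1.
rewrite -scalerA scalerBr !scalerA [b _ * (u n.+1).[y]]mulrC.
rewrite -[((u n.+1).[y] * _) *: _]scalerA recS recSy.
by rewrite -!mul_polyC !polyCM !polyCB !polyCM !polyCB; ring.
Qed.

(** At a root z the Christoffel-Darboux identity loses one of its two left-hand terms. Evaluating
    the rest at the conjugate of z, or differentiating it at z, would make a positive sum of squared
    moduli vanish if z were not real or not simple. *)
Lemma sonine_simple_real_root (R : rcfType) (alpha n : nat) (z : R[i]) :
  let p := map_poly (real_complex R) (sonine R alpha n) in
  root p z -> p^`().[z] != 0 /\ complex.Im z = 0.
Proof.
case: n => [|n] p.
  by rewrite /p sonine0 map_polyC rootC /= fmorph_eq0 invr_eq0 (negbTE (natr_fact_neq0 _ _)).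
move=> pz0.
pose u k := map_poly (real_complex R) (sonine R alpha k).
pose a k : R[i] := (k.*2 + alpha + 1)%:R.
pose b k : R[i] := (k.+1 * (k + alpha).+1)%:R.
pose w k := \prod_(i < k) b i.
have w_gt0 k : 0 < w k by apply: prodr_gt0 => i _; rewrite ltr0n.
have u0 : u 0 = (real_complex R (alpha`!%:R)^-1)%:P by rewrite /u sonine0 map_polyC.
have CD (y : R[i]) : (u n.+1).[y] = 0 ->
    w n.+1 *: ((u n).[y] *: u n.+1) =
    (y%:P - 'X) * \sum_(k < n.+1) (w k * (u k).[y]) *: u k.
  move=> uy0; rewrite -(@christoffel_darboux _ _ a b _ _ _ u0).
  - by rewrite uy0 scale0r subr0.
  - rewrite /u /a /b mul1n add0n addn1 -(rmorph_nat (real_complex R)) -map_polyZ sonine_rec0.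
    by rewrite rmorphM rmorphB /= map_polyX map_polyC.
  - move=> k; rewrite /u /a /b addSn -(rmorph_nat (real_complex R)) -map_polyZ sonine_rec.
    rewrite rmorphB rmorphM rmorphB /= map_polyX map_polyC /= rmorph_nat.
    by rewrite doubleS !addSn -addnS -addnS.
have uc k (y : R[i]) : (u k).[conjc y] = conjc (u k).[y].
  rewrite /u -horner_map /= -map_poly_comp; congr _.[_]; apply: eq_map_poly => x /=.
  exact/esym/conjc_real.
(* Strictness comes from the term of index 0, a nonzero constant polynomial. *)
have sum_gt0 : 0 < \sum_(k < n.+1) w k * ((u k).[z] * conjc (u k).[z]).
  rewrite big_ord_recl ltr_pwDl //.
    rewrite mulr_gt0 // u0 hornerC conjc_real -rmorphM /= ltcR.
    by rewrite -expr2 exprn_gt0 // invr_gt0 ltr0n fact_gt0.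
  by apply: sumr_ge0 => i _; rewrite mulr_ge0 ?mulcJ_ge0 // ltW.
have pz : (u n.+1).[z] = 0 by exact/eqP.
have zr : conjc z = z.
  (* The conjugate of z is also a root, the coefficients being real, so the left-hand side vanishes
     there. *)
  have /(congr1 (horner^~ (conjc z))) := CD z pz.
  rewrite 2!hornerZ uc pz conjc0 mulr0 mulr0 hornerM hornerD hornerN hornerX hornerC.
  move=> /esym/eqP; rewrite mulf_eq0 => /orP[].
    by rewrite subr_eq0 => /eqP <-.
  rewrite horner_sum (eq_bigr (fun k : 'I_n.+1 => w k * ((u k).[z] * conjc (u k).[z]))).
    by rewrite (gt_eqF sum_gt0).
  by move=> i _; rewrite hornerZ uc mulrA.
split; last first.
  case: z zr {pz0 sum_gt0 pz} => x y [] /eqP.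
  by rewrite eq_sym -addr_eq0 -mulr2n mulrn_eq0 /= => /eqP.
apply/eqP => dp0.
have /(congr1 (fun q : {poly R[i]} => q^`().[z])) := CD z pz.
rewrite !derivZ derivM derivB derivX derivC !hornerZ dp0 !mulr0 hornerD !hornerM.
rewrite !hornerD !hornerN hornerX !hornerC subrr mul0r addr0 => /esym/eqP.
rewrite sub0r mulN1r oppr_eq0 horner_sum.
rewrite (eq_bigr (fun k : 'I_n.+1 => w k * ((u k).[z] * conjc (u k).[z]))).
  by rewrite (gt_eqF sum_gt0).
by move=> i _; rewrite hornerZ -uc zr mulrA.
Qed.

(** Over [R[i]] the polynomial splits into n linear factors; they are distinct by simplicity of the
    roots, and the roots are real, so none is lost in [R]. *)
Lemma size_rootsR_sonine (R : rcfType) (alpha n : nat) :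
  size (rootsR (sonine R alpha n)) = n.
Proof.
pose p := sonine R alpha n; pose pC := map_poly (real_complex R) p.
have [r pCE] := closed_field_poly_normal pC.
have p0 : p != 0 by rewrite -size_poly_eq0 size_sonine.
have pC0 : pC != 0 by rewrite map_poly_eq0.
have sr : size r = n.
  have := congr1 (fun q : {poly R[i]} => size q) pCE.
  by rewrite size_scale ?lead_coef_eq0 // size_prod_XsubC size_map_poly size_sonine => -[].
have rootC z : root pC z = (z \in r).
  by rewrite pCE rootZ ?lead_coef_eq0 // root_prod_XsubC.
have ur : uniq r.
  have lc0 : lead_coef pC != 0 by rewrite lead_coef_eq0.
  rewrite -separable_prod_XsubC -(eqp_separable (eqp_scale _ lc0)) -pCE unlock.
  apply/Pdiv.ClosedField.coprimepP => z pz.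
  by have [] := sonine_simple_real_root pz.
have realr z : z \in r -> z = real_complex R (complex.Re z).
  by rewrite -rootC => /sonine_simple_real_root[_]; case: z => x y /= ->.
rewrite -/p -[RHS]sr -(size_map (@complex.Re R) r); apply/perm_size/uniq_perm.
- exact: uniq_roots.
- by rewrite map_inj_in_uniq // => x y /realr -> /realr ->; rewrite /= => ->.
move=> x; have := roots_on_rootsR p0 => /(_ x); rewrite inE /= => <-.
apply/idP/mapP => [px|[z zr ->]].
  by exists (real_complex R x) => //; rewrite -rootC fmorph_root.
by rewrite -(fmorph_root (real_complex R)) /= -[X in root _ X]realr // rootC.
Qed.

(** * Generators, Casimir polynomials and harmonic polynomials *)

Section Generators.
Variables (K : numFieldType) (T : 'I_8 -> 'M[K]_3).
Hypothesis tr_gen : forall A, \tr (T A) = 0.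
Hypothesis tr_gen2 : forall A B, \tr (T A *m T B) = (A == B)%:R / 2%:R.

(* Together with the identity matrix the generators have an explicit trace-dual
   family of 9 matrices; a right inverse of a square matrix is a left inverse. *)
Lemma fierz (i j k l : 'I_3) :
  \sum_A T A i j * T A k l =
  ((i == l) && (j == k))%:R / 2%:R - ((i == j) && (k == l))%:R / 6%:R.
Proof.
pose B (a : 'I_(8 + 1)) := match split a with inl A => T A | inr _ => 1%:M end.
pose D (a : 'I_(8 + 1)) :=
  match split a with inl A => 2%:R *: T A | inr _ => 3%:R^-1 *: 1%:M end.
pose M : 'M[K]_9 := \matrix_(a, p) mxvec (B a) 0 p.
pose N : 'M[K]_9 := \matrix_(p, b) mxvec (D b)^T 0 p.
have trBD a b : \tr (B a *m D b) = (a == b)%:R.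
  rewrite /B /D -(splitK a) -(splitK b) !unsplitK.
  case: (split a) (split b) => [A|u] [A'|v] /=.
  - by rewrite -scalemxAr linearZ /= tr_gen2 mulrCA divff ?mulr1 ?pnatr_eq0 ?eq_lshift.
  - by rewrite -scalemxAr mulmx1 linearZ /= tr_gen mulr0 eq_lrshift.
  - by rewrite mul1mx linearZ /= tr_gen mulr0 eq_rlshift.
  - by rewrite mul1mx linearZ /= mxtrace1 mulVf ?pnatr_eq0 // !ord1 eqxx.
have MN : M *m N = 1%:M.
  apply/matrixP => a b; rewrite !mxE -trBD.
  rewrite (reindex _ (curry_mxvec_bij 3 3)) /= /mxtrace.
  rewrite (eq_bigr (fun c => \sum_d B a c d * D b d c)); last by move=> c _; rewrite mxE.
  by rewrite pair_bigA /=; apply: eq_bigr => -[c d] _ /=; rewrite !mxE !mxvecE mxE.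
have /matrixP/(_ (mxvec_index j i) (mxvec_index k l)) := mulmx1C MN.
rewrite mxE [RHS]mxE.
have -> : (mxvec_index j i == mxvec_index k l) = ((j == k) && (i == l)).
  by rewrite /mxvec_index (inj_eq (@cast_ord_inj _ _ _)) (inj_eq enum_rank_inj) xpair_eqE.
rewrite (@big_split_ord _ _ _ 8 1) /= big_ord1 !mxE !mxvecE.
have DB A : D (lshift 1 A) = 2%:R *: T A /\ B (lshift 1 A) = T A.
  by rewrite /D /B (unsplitK (inl A)).
have [-> ->] : D (rshift 8 ord0) = 3%:R^-1 *: 1%:M /\ B (rshift 8 ord0) = 1%:M.
  by rewrite /D /B (unsplitK (inr ord0)).
rewrite (eq_bigr (fun A => 2%:R * (T A i j * T A k l))); last first.
  by move=> A _; have [dA bA] := DB A; rewrite !mxE !mxvecE bA dA !mxE mulrA.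
rewrite !mxE.
rewrite -mulr_sumr andbC => e.
have {e} : 2%:R * \sum_A T A i j * T A k l =
  ((i == l) && (j == k))%:R - 3%:R^-1 * ((i == j)%:R * (k == l)%:R).
  by rewrite -e mulrA addrK.
rewrite -natrM mulnb => e; apply: (@mulfI _ 2%:R); rewrite ?pnatr_eq0 // e.
by field.
Qed.

Section Extension.
Variables (S : comNzRingType) (f : {rmorphism K -> S}).
Let t A := map_mx f (T A).

(** The entries of [Y] live in an extension [S] of the scalars: polynomials via [mpolyC] for
    gradients, and the field itself via [idfun] for coordinates. *)
Lemma fierz_mx (Y : 'M[S]_3) :
  \sum_A \tr (t A *m Y) *: t A = f 2%:R^-1 *: Y - (f 6%:R^-1 * \tr Y)%:M.
Proof.
apply/matrixP => k l; rewrite summxE !mxE.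
transitivity (\sum_i \sum_j Y j i * f (\sum_A T A i j * T A k l)).
  rewrite (eq_bigr (fun A => \sum_i \sum_j t A i j * Y j i * t A k l)); last first.
    move=> A _; rewrite mxE /mxtrace mulr_suml; apply: eq_bigr => i _.
    by rewrite mxE mulr_suml.
  rewrite exchange_big; apply: eq_bigr => i _; rewrite exchange_big; apply: eq_bigr => j _.
  rewrite rmorph_sum mulr_sumr; apply: eq_bigr => A _.
  by rewrite !mxE rmorphM [RHS]mulrCA mulrA.
transitivity (\sum_i \sum_j ((i == l)%:R * ((j == k)%:R * (f 2%:R^-1 * Y j i))
    - (j == i)%:R * ((k == l)%:R * (f 6%:R^-1 * Y j i)))).
  apply: eq_bigr => i _; apply: eq_bigr => j _; rewrite fierz rmorphB !rmorphM.
  rewrite /= !rmorph_nat -!mulnb !natrM (eq_sym j i); ring.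
under eq_bigr do rewrite sumrB.
rewrite sumrB; congr (_ - _).
  rewrite (bigD1 l) //= [X in _ + X]big1 ?addr0 => [|i /negbTE->]; last first.
    by apply: big1 => j _; rewrite mul0r.
  rewrite (bigD1 k) //= big1 ?addr0 => [|j /negbTE->]; last by rewrite mul0r mulr0.
  by rewrite !eqxx !mul1r.
rewrite -[RHS]mulr_natl [\tr Y]/mxtrace !mulr_sumr; apply: eq_bigr => i _.
rewrite (bigD1 i) //= big1 ?addr0 => [|j /negbTE->]; last by rewrite mul0r.
by rewrite eqxx mul1r.
Qed.

Lemma fierz_tr (Y Z : 'M[S]_3) :
  \sum_A \tr (t A *m Y) * \tr (t A *m Z) =
  f 2%:R^-1 * \tr (Y *m Z) - f 6%:R^-1 * \tr Y * \tr Z.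
Proof.
have /(congr1 (fun M => \tr (M *m Z))) := fierz_mx Y.
rewrite mulmxBl linearB /= -scalemxAl linearZ /= mul_scalar_mx linearZ /= => <-.
rewrite mulmx_suml linear_sum; apply: eq_bigr => A _.
by rewrite /= -scalemxAl linearZ.
Qed.

(** The value 4/3 is the quadratic Casimir of the fundamental representation. Since the sum is a
    scalar matrix, the Laplacian of p3 becomes a multiple of tr X = 0. *)
Lemma sum_gen_sqr : \sum_A t A *m t A = (f (4%:R / 3%:R))%:M.
Proof.
apply/matrixP => i l; rewrite summxE mxE.
transitivity (\sum_j f (\sum_A T A i j * T A j l)).
  under eq_bigr do rewrite mxE.
  rewrite exchange_big; apply: eq_bigr => j _; rewrite rmorph_sum.
  by apply: eq_bigr => A _; rewrite !mxE rmorphM.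
rewrite -rmorph_sum -raddfMn; congr (f _).
under eq_bigr do rewrite fierz eqxx andbT.
rewrite !big_ord_recl big_ord0.
by case: i l => [[|[|[|//]]] ?] [[|[|[|//]]] ?] /=; rewrite ?mulr1n ?mulr0n; field.
Qed.

End Extension.
End Generators.

(* Cayley-Hamilton for a traceless 3 x 3 matrix. *)
Lemma traceless_tr4 (S : comNzRingType) (M : 'M[S]_3) :
  \tr M = 0 -> 2%:R * \tr ((M *m M) *m (M *m M)) = \tr (M *m M) ^+ 2.
Proof.
pose i0 : 'I_3 := 0; pose i1 : 'I_3 := 1; pose i2 : 'I_3 := 2%:R.
have sum3 (F : 'I_3 -> S) : \sum_i F i = F i0 + F i1 + F i2.
  rewrite !big_ord_recl big_ord0 addr0 addrA.
  by congr (F _ + F _ + F _); apply/val_inj.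
have mul3 (A B : 'M[S]_3) i j : (A *m B) i j = A i i0 * B i0 j + A i i1 * B i1 j + A i i2 * B i2 j.
  by rewrite mxE sum3.
rewrite /mxtrace !sum3 => /eqP; rewrite addrC addr_eq0 => /eqP tr0.
rewrite !mul3 tr0; ring.
Qed.

Lemma mxtrace_cyclic3 (S : comNzRingType) (n : nat) (B Y : 'M[S]_n) :
  \tr (B *m Y *m Y) + \tr (Y *m B *m Y) + \tr (Y *m Y *m B) = 3%:R * \tr (B *m (Y *m Y)).
Proof.
have -> : \tr (Y *m B *m Y) = \tr (B *m (Y *m Y)).
  by rewrite -mulmxA mxtrace_mulC mulmxA.
have -> : \tr (Y *m Y *m B) = \tr (B *m (Y *m Y)) by rewrite mxtrace_mulC.
by rewrite -mulmxA; ring.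
Qed.

Lemma mxtrace_cyclic2 (S : comNzRingType) (n : nat) (B Y : 'M[S]_n) :
  \tr (B *m (B *m Y + Y *m B)) = 2%:R * \tr (B *m B *m Y).
Proof.
rewrite mulmxDr mxtraceD mulmxA.
have -> : \tr (B *m (Y *m B)) = \tr (B *m B *m Y) by rewrite mulmxA mxtrace_mulC mulmxA.
by ring.
Qed.

(** The constant is 1/12 = 1/4 - 1/6: half of tr Y^4 = (tr Y^2)^2 / 2, minus the trace part of the
    completeness relation. *)
Lemma fierz_traceless_sqr (K : numFieldType) (T : 'I_8 -> 'M[K]_3)
    (S : comNzRingType) (f : {rmorphism K -> S}) (Y : 'M[S]_3) :
  (forall A, \tr (T A) = 0) ->
  (forall A B, \tr (T A *m T B) = (A == B)%:R / 2%:R) ->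
  \tr Y = 0 ->
  \sum_A \tr (map_mx f (T A) *m (Y *m Y)) * \tr (map_mx f (T A) *m (Y *m Y)) =
  f 12%:R^-1 * \tr (Y *m Y) ^+ 2.
Proof.
move=> tr_gen tr_gen2 trY; rewrite fierz_tr // -mulrA -expr2 -(traceless_tr4 trY).
rewrite !mulrA -(rmorph_nat f 2) -!rmorphM -mulrBl -rmorphB.
by congr (f _ * _); field.
Qed.

(** * Casimir polynomials and the Laplacian *)

Definition genmx (K : fieldType) (T : 'I_8 -> 'M[K]_3) : 'M[{mpoly K[8]}]_3 :=
  \matrix_(i, j) \sum_A T A i j *: 'X_A.

Definition casimir2 (K : fieldType) (T : 'I_8 -> 'M[K]_3) : {mpoly K[8]} :=
  \tr (genmx T *m genmx T).

Definition casimir3 (K : fieldType) (T : 'I_8 -> 'M[K]_3) : {mpoly K[8]} :=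
  \tr (genmx T *m genmx T *m genmx T).

Definition laplacian (K : fieldType) (n : nat) (f : {mpoly K[n]}) : {mpoly K[n]} :=
  \sum_(A < n) f^`M(A)^`M(A).

Lemma laplacianZ (K : fieldType) (n : nat) (c : K) (f : {mpoly K[n]}) :
  laplacian (c *: f) = c *: laplacian f.
Proof. by rewrite /laplacian scaler_sumr; apply: eq_bigr => A _; rewrite !mderivZ. Qed.

Lemma laplacianD (K : fieldType) (n : nat) (f g : {mpoly K[n]}) :
  laplacian (f + g) = laplacian f + laplacian g.
Proof. by rewrite /laplacian -big_split; apply: eq_bigr => A _; rewrite !mderivD. Qed.

Lemma laplacianM (K : fieldType) (n : nat) (f g : {mpoly K[n]}) :
  laplacian (f * g) =
  laplacian f * g + 2%:R * (\sum_A f^`M(A) * g^`M(A)) + f * laplacian g.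
Proof.
rewrite /laplacian mulr_suml !mulr_sumr -!big_split; apply: eq_bigr => A _ /=.
by rewrite !(mderivM, mderivD); ring.
Qed.

Lemma mderivXU (K : fieldType) (n : nat) (A B : 'I_n) :
  ('X_B : {mpoly K[n]})^`M(A) = (B == A)%:R.
Proof.
rewrite mderivX mnm1E; case: eqP => [->|_]; last by rewrite scale0r.
by rewrite scale1r -[X in (X - _)%MM]add0m addmK mpolyX0.
Qed.

Lemma euler_homog (K : fieldType) (n d : nat) (f : {mpoly K[n]}) :
  f \is d.-homog -> \sum_A 'X_A * f^`M(A) = d%:R *: f.
Proof.
move=> /dhomogP fd; rewrite [in LHS](mpolyE f) [in RHS](mpolyE f).
under eq_bigr => A _ do rewrite linear_sum mulr_sumr.
rewrite exchange_big scaler_sumr !big_seq; apply: eq_bigr => m /fd <-.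
rewrite [X in X%:R *: _](mdegE m : _ = _) natr_sum scaler_suml; apply: eq_bigr => A _ /=.
rewrite mderivZ mderivX -scalerAr [_ *: (_ *: 'X_[_])]scalerA -scalerAr.
have [->|m0] := posnP (m A); first by rewrite mul0r !scale0r scaler0.
rewrite -mpolyXD addmC submK; last first.
  apply/mnm_lepP => B; rewrite mnm1E; case: eqP => [<-|] //.
by rewrite !scalerA mulrC.
Qed.

Section Casimirs.
Variables (K : numFieldType) (T : 'I_8 -> 'M[K]_3).
Hypothesis tr_gen : forall A, \tr (T A) = 0.
Hypothesis tr_gen2 : forall A B, \tr (T A *m T B) = (A == B)%:R / 2%:R.
Let X := genmx T.
Let p2 := casimir2 T.
Let p3 := casimir3 T.
Let t A := map_mx (@mpolyC 8 K) (T A).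

Lemma tr_genmx : \tr X = 0.
Proof.
rewrite /mxtrace; under eq_bigr do rewrite mxE.
rewrite exchange_big big1 // => A _; rewrite -scaler_suml.
by rewrite -/(\tr (T A)) tr_gen scale0r.
Qed.

Lemma tr_gen_genmx A : \tr (t A *m X) = 2%:R^-1 *: 'X_A.
Proof.
transitivity (\sum_B \tr (T A *m T B) *: ('X_B : {mpoly K[8]})).
  rewrite /mxtrace; under eq_bigr do rewrite mxE.
  under [RHS]eq_bigr do rewrite scaler_suml.
  rewrite [RHS]exchange_big; apply: eq_bigr => i _.
  under [RHS]eq_bigr do rewrite mxE scaler_suml.
  rewrite [RHS]exchange_big; apply: eq_bigr => j _.
  rewrite !mxE mulr_sumr; apply: eq_bigr => B _.
  by rewrite mul_mpolyC scalerA.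
rewrite (bigD1 A) //= tr_gen2 eqxx mul1r big1 ?addr0 // => B /negbTE.
by rewrite tr_gen2 eq_sym => ->; rewrite mul0r scale0r.
Qed.

Lemma mderiv_genmx A : map_mx (mderiv A) X = t A.
Proof.
apply/matrixP => i j; rewrite !mxE linear_sum (bigD1 A) //= big1 ?addr0.
  by rewrite mderivZ mderivXU eqxx -mul_mpolyC mulr1.
by move=> B /negbTE nBA; rewrite mderivZ mderivXU nBA scaler0.
Qed.

Lemma mderiv_mulmx A (M N : 'M[{mpoly K[8]}]_3) :
  map_mx (mderiv A) (M *m N) = map_mx (mderiv A) M *m N + M *m map_mx (mderiv A) N.
Proof.
apply/matrixP => i j; rewrite !mxE linear_sum -big_split; apply: eq_bigr => k _.
by rewrite /= mderivM !mxE.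
Qed.

Lemma mderiv_mxtrace A (M : 'M[{mpoly K[8]}]_3) :
  (\tr M)^`M(A) = \tr (map_mx (mderiv A) M).
Proof. by rewrite linear_sum; apply: eq_bigr => i _; rewrite mxE. Qed.

Lemma mderiv_casimir2 A : p2^`M(A) = 'X_A.
Proof.
rewrite mderiv_mxtrace mderiv_mulmx mderiv_genmx linearD /= [\tr (_ *m t A)]mxtrace_mulC.
rewrite tr_gen_genmx -scalerDl -[RHS]scale1r; congr (_ *: _); by field.
Qed.

Lemma mderiv_casimir3 A : p3^`M(A) = 3%:R *: \tr (t A *m (X *m X)).
Proof.
rewrite mderiv_mxtrace 2!mderiv_mulmx mderiv_genmx mulmxDl !linearD /=.
by rewrite mxtrace_cyclic3 -mpolyC_nat mul_mpolyC.
Qed.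

Lemma grad_casimir3 : \sum_A p3^`M(A) * p3^`M(A) = (3%:R / 4%:R) *: p2 ^+ 2.
Proof.
transitivity (9%:R *: \sum_A \tr (t A *m (X *m X)) * \tr (t A *m (X *m X))).
  rewrite scaler_sumr; apply: eq_bigr => A _.
  by rewrite mderiv_casimir3 -scalerAl -scalerAr scalerA; congr (_ *: _); ring.
rewrite (fierz_traceless_sqr (@mpolyC 8 K) tr_gen tr_gen2 tr_genmx) mul_mpolyC scalerA.
by congr (_ *: _); field.
Qed.

Lemma laplacian_casimir3 : laplacian p3 = 0.
Proof.
rewrite /laplacian.
transitivity (6%:R *: \tr ((\sum_A t A *m t A) *m X)).
  rewrite mulmx_suml [\tr _]linear_sum /= scaler_sumr; apply: eq_bigr => A _.
  rewrite mderiv_casimir3 mderivZ mderiv_mxtrace !mderiv_mulmx mderiv_genmx.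
  have -> : map_mx (mderiv A) (t A) = 0.
    by apply/matrixP => i j; rewrite !mxE mderivC.
  by rewrite mul0mx add0r mxtrace_cyclic2 -mpolyC_nat mul_mpolyC scalerA -natrM.
rewrite (sum_gen_sqr tr_gen tr_gen2 (@mpolyC 8 K)) mul_scalar_mx linearZ /=.
by rewrite tr_genmx mulr0 scaler0.
Qed.

Lemma genmx_homog i j : X i j \is 1.-homog.
Proof.
rewrite mxE; apply: rpred_sum => A _; apply: rpredZ.
by rewrite dhomogX /= mdeg1.
Qed.

Lemma casimir2_homog : p2 \is 2.-homog.
Proof.
apply: rpred_sum => i _; rewrite mxE; apply: rpred_sum => j _.
exact: (dhomogM (genmx_homog _ _) (genmx_homog _ _)).
Qed.

Lemma casimir3_homog : p3 \is 3.-homog.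
Proof.
apply: rpred_sum => i _; rewrite mxE; apply: rpred_sum => j _.
rewrite mxE mulr_suml; apply: rpred_sum => k _.
exact: (dhomogM (dhomogM (genmx_homog _ _) (genmx_homog _ _)) (genmx_homog _ _)).
Qed.

Lemma casimir_homog (j k : nat) : p2 ^+ j * p3 ^+ k \is (2 * j + 3 * k).-homog.
Proof. exact: (dhomogM (dhomogMn _ casimir2_homog) (dhomogMn _ casimir3_homog)). Qed.

Lemma laplacian_casimir2M (d : nat) (f : {mpoly K[8]}) : f \is d.-homog ->
  laplacian (p2 * f) = (8 + 2 * d)%:R *: f + p2 * laplacian f.
Proof.
move=> fd; rewrite laplacianM; congr (_ + _).
under eq_bigr do rewrite mderiv_casimir2.
rewrite (euler_homog fd) /laplacian.
under eq_bigr do rewrite mderiv_casimir2 mderivXU eqxx.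
rewrite sumr_const card_ord -mulr_natl mulr1 -!mul_mpolyC -!mpolyC_nat mulrA -mulrDl.
by rewrite -mpolyCM -mpolyCD -natrM -natrD.
Qed.

(** Each further factor p2 contributes 8 plus twice the current degree, by Euler's identity. For n =
    0 the truncated [n.-1] carries the coefficient 0. *)
Lemma laplacian_casimir2X (d n : nat) (f : {mpoly K[8]}) : f \is d.-homog ->
  laplacian (p2 ^+ n * f) =
  (2 * n * (n + 3 + d))%:R *: (p2 ^+ n.-1 * f) + p2 ^+ n * laplacian f.
Proof.
move=> fd; elim: n => [|n IHn].
  by rewrite muln0 mul0n scale0r add0r !mul1r.
rewrite exprS -mulrA.
rewrite (laplacian_casimir2M (dhomogM (dhomogMn n casimir2_homog) fd)) IHn mulrDr addrA.
congr (_ + _); last by rewrite mulrA -exprS.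
rewrite -scalerAr mulrA -exprS.
case: n {IHn} => [|n] /=; rewrite ?muln0 ?mul0n ?scale0r ?addr0.
  by congr (_%:R *: _); lia.
by rewrite -scalerDl -natrD; congr (_%:R *: _); lia.
Qed.

(** As p3 is itself harmonic, only products of two gradients survive, and these are multiples of
    p2^2. *)
Lemma laplacian_casimir3X (k : nat) :
  laplacian (p3 ^+ k) = (3%:R / 4%:R * (k * k.-1)%:R) *: (p2 ^+ 2 * p3 ^+ k.-2).
Proof.
have dX n A : (p3 ^+ n)^`M(A) = n%:R *: (p3 ^+ n.-1 * p3^`M(A)).
  elim: n => [|n IHn]; first by rewrite scale0r expr0 -mpolyC1 mderivC.
  rewrite exprS mderivM IHn /= -scalerAr mulrA -exprS.
  case: n {IHn} => [|n] /=; first by rewrite !scale0r !addr0 scale1r expr0 mulr1 mul1r.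
  by rewrite mulrC -(natr1 n.+1) scalerDl scale1r addrC.
elim: k => [|k IHk].
  by rewrite mulr0 scale0r /laplacian big1 // => A _; rewrite expr0 -mpolyC1 !mderivC.
rewrite exprS laplacianM laplacian_casimir3 mul0r add0r IHk.
have -> : \sum_A p3^`M(A) * (p3 ^+ k)^`M(A) = (k%:R * (3%:R / 4%:R)) *: (p2 ^+ 2 * p3 ^+ k.-1).
  transitivity (k%:R *: (p3 ^+ k.-1 * \sum_A p3^`M(A) * p3^`M(A))).
    rewrite mulr_sumr scaler_sumr; apply: eq_bigr => A _.
    by rewrite dX -scalerAr; congr (_ *: _); ring.
  by rewrite grad_casimir3 -scalerAr scalerA mulrC [p3 ^+ _ * _]mulrC.
case: k {IHk} => [|[|k]] /=.
- by rewrite !(mul0r, mul0n, mulr0, scale0r, addr0).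
- rewrite muln0 mulr0 scale0r mulr0 addr0 mulr_natl -scaler_nat scalerA.
  by congr (_ *: _); field.
rewrite mulr_natl -scaler_nat scalerA -scalerAr [p3 * (_ * _)]mulrCA -exprS -scalerDl.
by congr (_ *: _); rewrite !natrM -(natr1 k.+2) -(natr1 k.+1); field.
Qed.

End Casimirs.

(** * Harmonic polynomials *)

(** This is binomial(k - t, t) / (-24)^t, the solution with value 1 at t = 0 of the recurrence
    [harm_coefS]. It unifies the even and odd Gamma coefficients. *)
Definition harm_coef (K : fieldType) (k t : nat) : K :=
  (- 24%:R) ^- t * ((k - t)`!%:R / (t`! * (k - 2 * t)`!)%:R).

Definition harmonic (K : fieldType) (T : 'I_8 -> 'M[K]_3) (k : nat) : {mpoly K[8]} :=
  \sum_(t < k./2.+1) harm_coef K k t *: (casimir2 T ^+ (3 * t) * casimir3 T ^+ (k - 2 * t)).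

Section Harmonic.
Variables (K : numFieldType) (T : 'I_8 -> 'M[K]_3).
Hypothesis tr_gen : forall A, \tr (T A) = 0.
Hypothesis tr_gen2 : forall A B, \tr (T A *m T B) = (A == B)%:R / 2%:R.

(** The last factor on the left is 3 (k - t), so the ratio of consecutive coefficients is -(3/4)/18
    = -1/24 times (k - 2t)(k - 2t - 1) / ((t + 1)(k - t)). *)
Lemma harm_coefS (k t : nat) : (2 * t.+1 <= k)%N ->
  harm_coef K k t.+1 * (2 * (3 * t.+1) * (3 * t.+1 + 3 + 3 * (k - 2 * t.+1)))%:R =
  - (harm_coef K k t * (3%:R / 4%:R * ((k - 2 * t) * (k - 2 * t).-1)%:R)).
Proof.
move=> le_tk; pose m := (k - 2 * t.+1)%N.
(* Parametrizing by m removes all truncated subtractions. *)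
have -> : k = (m + 2 * t.+1)%N by rewrite subnK.
rewrite addnK /harm_coef exprS addnK.
have -> : (m + 2 * t.+1 - t.+1 = m + t.+1)%N by lia.
have -> : (m + 2 * t.+1 - t = (m + t.+1).+1)%N by lia.
have -> : (m + 2 * t.+1 - 2 * t = m.+2)%N by lia.
rewrite !factS [m.+2.-1]/= !natrM.
have -> : (m + t.+1).+1%:R = m%:R + (t%:R + 1) + 1 :> K by rewrite !natr1 -natrD natr1.
have -> : (3 * t.+1 + 3 + 3 * m)%:R = 3%:R * (t%:R + 1) + 3%:R + 3%:R * m%:R :> K.
  by rewrite (natr1 t) -!natrM -!natrD.
rewrite -(natr1 m.+1) -(natr1 m) -(natr1 t).
have m0 := natr_fact_neq0 K m; have t0 := natr_fact_neq0 K t.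
have a1 : m%:R + 1 != 0 :> K by rewrite natr1 pnatr_eq0.
have a2 : m%:R + 1 + 1 != 0 :> K by rewrite !natr1 pnatr_eq0.
have a3 : t%:R + 1 != 0 :> K by rewrite natr1 pnatr_eq0.
have a4 : (- 24%:R) ^+ t != 0 :> K by rewrite expf_neq0 // oppr_eq0 pnatr_eq0.
move: ((- 24%:R) ^+ t) a4 (m`!%:R) m0 (t`!%:R) t0 ((m + t.+1)`!%:R) => x x0 y y0 z z0 w.
by field; rewrite ?x0 ?y0 ?z0 ?a1 ?a2 ?a3.
Qed.

Lemma harmonic_homog (k : nat) : harmonic T k \is (3 * k).-homog.
Proof.
apply: rpred_sum => t _; apply: rpredZ.
have -> : (3 * k = 2 * (3 * t) + 3 * (k - 2 * t))%N.
  by have := ltn_ord t; rewrite ltnS; have := odd_double_half k; lia.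
exact: casimir_homog.
Qed.

(** The sum telescopes: the derivative of p2 powers in term t + 1 cancels the derivative of p3
    powers in term t. *)
Lemma laplacian_harmonic (k : nat) : laplacian (harmonic T k) = 0.
Proof.
pose F t := casimir2 T ^+ (3 * t).-1 * casimir3 T ^+ (k - 2 * t).
pose a t : K := harm_coef K k t * (2 * (3 * t) * (3 * t + 3 + 3 * (k - 2 * t)))%:R.
pose b t : K := harm_coef K k t * (3%:R / 4%:R * ((k - 2 * t) * (k - 2 * t).-1)%:R).
have lapF t : laplacian (harm_coef K k t *: (casimir2 T ^+ (3 * t) * casimir3 T ^+ (k - 2 * t))) =
    a t *: F t + b t *: F t.+1.
  have hom : casimir3 T ^+ (k - 2 * t) \is (3 * (k - 2 * t)).-homog.
    exact: (dhomogMn _ (casimir3_homog T)).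
  rewrite laplacianZ (laplacian_casimir2X tr_gen2 _ hom).
  rewrite laplacian_casimir3X // scalerDr scalerA; congr (_ + _).
  have e1 : ((3 * t.+1).-1 = 3 * t + 2)%N by lia.
  have e2 : (k - 2 * t.+1 = (k - 2 * t).-2)%N by lia.
  by rewrite -scalerAr scalerA [_ ^+ _ * (_ * _)]mulrA -exprD /F e1 e2.
have lap_sum (I : finType) (G : I -> {mpoly K[8]}) :
    laplacian (\sum_i G i) = \sum_i laplacian (G i).
  apply: (big_morph (@laplacian K 8) (@laplacianD K 8)).
  by rewrite /laplacian big1 // => A _; rewrite !mderiv0.
rewrite /harmonic lap_sum; under eq_bigr do rewrite lapF.
rewrite big_split /= big_ord_recl big_ord_recr /= {1}/a muln0 muln0 mul0n mulr0 scale0r add0r.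
(* At the last index the exponent k - 2t of p3 is 0 or 1, so nothing is left to cancel; at t = 0 the
   coefficient [a] vanishes. *)
have -> : b k./2 = 0.
  rewrite /b; have -> : (k - 2 * k./2 = odd k)%N by have := odd_double_half k; lia.
  by case: (odd k); rewrite !mulr0.
rewrite scale0r addr0 -big_split big1 // => t _ /=.
rewrite /bump /= add1n -scalerDl /a harm_coefS ?addNr ?scale0r //.
by have := ltn_ord t; have := odd_double_half k; lia.
Qed.

Lemma laplacian_casimir2X_harmonic (n k : nat) :
  laplacian (casimir2 T ^+ n * harmonic T k) =
  (2 * n * (n + 3 + 3 * k))%:R *: (casimir2 T ^+ n.-1 * harmonic T k).
Proof.
rewrite (laplacian_casimir2X tr_gen2 _ (harmonic_homog k)).
by rewrite laplacian_harmonic mulr0 addr0.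
Qed.

End Harmonic.

(** * The Hamiltonian as a differential operator *)

(** Keeping [G] arbitrary lets one contraction serve both the number term and the term with two
    annihilators. *)
Lemma gen_contract (K : numFieldType) (T : 'I_8 -> 'M[K]_3) (V : lmodType K)
    (G : 'I_8 -> 'I_8 -> V) :
  (forall A B, \tr (T A *m T B) = (A == B)%:R / 2%:R) ->
  \sum_i \sum_k \sum_A T A i k *: (\sum_B T B k i *: G A B) = 2%:R^-1 *: \sum_A G A A.
Proof.
move=> tr_gen2.
transitivity (\sum_A \sum_B \tr (T A *m T B) *: G A B).
  under eq_bigr do rewrite exchange_big.
  rewrite exchange_big; apply: eq_bigr => A _.
  under eq_bigr do under eq_bigr do rewrite scaler_sumr.
  under eq_bigr do rewrite exchange_big.
  rewrite exchange_big; apply: eq_bigr => B _.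
  rewrite /mxtrace scaler_suml; apply: eq_bigr => i _.
  by rewrite mxE scaler_suml; apply: eq_bigr => k _; rewrite scalerA.
rewrite scaler_sumr; apply: eq_bigr => A _.
rewrite (bigD1 A) //= tr_gen2 eqxx mul1r big1 ?addr0 // => B /negbTE.
by rewrite tr_gen2 eq_sym => ->; rewrite mul0r scale0r.
Qed.

Lemma iter_mul (S : pzRingType) (F : S -> S) (c x : S) (n : nat) :
  (forall y, F y = c * y) -> iter n F x = c ^+ n * x.
Proof.
by move=> Fc; elim: n => [|n IHn] /=; rewrite ?expr0 ?mul1r // IHn Fc exprS mulrA.
Qed.

(** Since the generators have trace form 1/2, (a^dagger a) is half the Euler operator, and half of
    (a a) is a quarter of the Laplacian. *)
Definition diff_ham (K : fieldType) (T : 'I_8 -> 'M[K]_3) (f : {mpoly K[8]}) : {mpoly K[8]} :=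
  2%:R^-1 *: (\sum_A 'X_A * f^`M(A)) + 2%:R *: f - 2%:R^-1 *: (casimir2 T * f)
  - 4%:R^-1 *: laplacian f.

Lemma diff_hamD (K : fieldType) (T : 'I_8 -> 'M[K]_3) (f g : {mpoly K[8]}) :
  diff_ham T (f + g) = diff_ham T f + diff_ham T g.
Proof.
rewrite /diff_ham; under eq_bigr do rewrite mderivD mulrDr.
rewrite big_split laplacianD /= mulrDr !scalerDr !opprD.
by ring.
Qed.

Lemma diff_hamZ (K : fieldType) (T : 'I_8 -> 'M[K]_3) (c : K) (f : {mpoly K[8]}) :
  diff_ham T (c *: f) = c *: diff_ham T f.
Proof.
rewrite /diff_ham; under eq_bigr do rewrite mderivZ -scalerAr.
rewrite -scaler_sumr laplacianZ -scalerAr !scalerBr scalerDr.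
have sw (a : K) (g : {mpoly K[8]}) : a *: (c *: g) = c *: (a *: g) by rewrite !scalerA mulrC.
by rewrite 4!sw.
Qed.

Lemma diff_ham_casimir2X_harmonic (K : numFieldType) (T : 'I_8 -> 'M[K]_3) (n k : nat) :
  (forall A, \tr (T A) = 0) ->
  (forall A B, \tr (T A *m T B) = (A == B)%:R / 2%:R) ->
  diff_ham T (casimir2 T ^+ n * harmonic T k) =
  ((2 * n + 3 * k + 4)%:R / 2%:R) *: (casimir2 T ^+ n * harmonic T k)
  - 2%:R^-1 *: (casimir2 T ^+ n.+1 * harmonic T k)
  - ((n * (n + 3 + 3 * k))%:R / 2%:R) *: (casimir2 T ^+ n.-1 * harmonic T k).
Proof.
move=> tr_gen tr_gen2; rewrite /diff_ham.
rewrite (euler_homog (dhomogM (dhomogMn n (casimir2_homog T)) (harmonic_homog T k))).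
rewrite (laplacian_casimir2X_harmonic tr_gen tr_gen2) mulrA -exprS !scalerA -scalerDl.
have -> : 2%:R^-1 * (2 * n + 3 * k)%:R + 2%:R = (2 * n + 3 * k + 4)%:R / 2%:R :> K.
  by rewrite [in RHS]natrD; field.
have -> // : 4%:R^-1 * (2 * n * (n + 3 + 3 * k))%:R = (n * (n + 3 + 3 * k))%:R / 2%:R :> K.
by rewrite -mulnA natrM; field.
Qed.

Section Fock.
Variables (R : rcfType) (T : 'I_8 -> 'M[R[i]]_3).

Lemma admxE i j (f : fock R) : admx T i j f = genmx T i j * f.
Proof.
rewrite /admx mxE mulr_suml; apply: eq_bigr => A _.
by rewrite /creat scalerAl.
Qed.

Lemma optr_admx2 (f : fock R) : optr (opmul (admx T) (admx T)) f = casimir2 T * f.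
Proof.
rewrite /optr /opmul /casimir2 /mxtrace mulr_suml; apply: eq_bigr => i _.
by rewrite mxE mulr_suml; apply: eq_bigr => k _; rewrite !admxE mulrA.
Qed.

Lemma optr_admx3 (f : fock R) :
  optr (opmul (opmul (admx T) (admx T)) (admx T)) f = casimir3 T * f.
Proof.
rewrite /optr /opmul /casimir3 /mxtrace mulr_suml; apply: eq_bigr => i _.
rewrite mxE mulr_suml; apply: eq_bigr => k _.
rewrite mxE !mulr_suml; apply: eq_bigr => l _.
by rewrite !admxE !mulrA.
Qed.

Lemma ketE (j k : nat) : ket T j k = casimir2 T ^+ j * casimir3 T ^+ k.
Proof.
rewrite /ket (iter_mul _ _ optr_admx3) (iter_mul _ _ optr_admx2).
by rewrite [_ ^+ k * _]mulr1.
Qed.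

Hypothesis tr_gen2 : forall A B, \tr (T A *m T B) = (A == B)%:R / 2%:R.

Lemma optr_admx_amx (f : fock R) :
  optr (opmul (admx T) (amx T)) f = 2%:R^-1 *: \sum_A 'X_A * f^`M(A).
Proof.
rewrite -(gen_contract (fun A B => 'X_A * f^`M(B)) tr_gen2).
apply: eq_bigr => i _; apply: eq_bigr => k _; apply: eq_bigr => A _.
rewrite /amx /creat mulr_sumr; congr (_ *: _).
by apply: eq_bigr => B _; rewrite -scalerAr.
Qed.

Lemma optr_amx2 (f : fock R) :
  optr (opmul (amx T) (amx T)) f = 2%:R^-1 *: laplacian f.
Proof.
rewrite -(gen_contract (fun A B => f^`M(B)^`M(A)) tr_gen2).
apply: eq_bigr => i _; apply: eq_bigr => k _; apply: eq_bigr => A _.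
congr (_ *: _); rewrite /amx /annih raddf_sum.
by apply: eq_bigr => B _; rewrite /= mderivZ.
Qed.

Lemma hamE (f : fock R) : ham T f = diff_ham T f.
Proof.
rewrite /ham optr_admx2 optr_admx_amx optr_amx2 scalerA.
by have -> : 2%:R^-1 * 2%:R^-1 = 4%:R^-1 :> R[i] by field.
Qed.

End Fock.

(** * Invariant polynomials *)

Lemma poly_eq0_nat (K : numDomainType) (q : {poly K}) :
  (forall t : nat, q.[t%:R] = 0) -> q = 0.
Proof.
move=> q0; pose r : seq K := [seq t%:R | t <- iota 0 (size q)].
apply: (@roots_geq_poly_eq0 _ _ r).
- by apply/allP => _ /mapP[t _ ->]; apply/eqP; exact: q0.
- by rewrite map_inj_uniq ?iota_uniq // => s t /eqP; rewrite eqr_nat => /eqP.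
- by rewrite size_map size_iota.
Qed.

Lemma base_digits_inj (n d : nat) (f g : 'I_n -> nat) :
  (forall i, f i < d)%N -> (forall i, g i < d)%N ->
  (\sum_i f i * d ^ i = \sum_i g i * d ^ i)%N -> f =1 g.
Proof.
elim: n f g => [|n IHn] f g lf lg; first by move=> _ [].
have shift (h : 'I_n.+1 -> nat) :
    (\sum_i h i * d ^ i = (\sum_(i < n) h (lift ord0 i) * d ^ i) * d + h ord0)%N.
  rewrite big_ord_recl expn0 muln1 addnC big_distrl; congr (_ + _)%N.
  by apply: eq_bigr => i _; rewrite /= /bump add1n expnS mulnA mulnAC.
have d0 : (0 < d)%N by apply: leq_ltn_trans (lf ord0).
rewrite !shift => e; have e0 : f ord0 = g ord0.
  by have := congr1 (modn^~ d) e; rewrite !modnMDl !modn_small.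
move/eqP: e; rewrite e0 eqn_add2r eqn_pmul2r // => /eqP e i.
case: (unliftP ord0 i) => [j ->|-> //].
exact: (IHn (fun j => f (lift ord0 j)) (fun j => g (lift ord0 j))).
Qed.

(* Kronecker substitution: along the curve [i |-> t ^ (d ^ i)] distinct monomials
   of degree less than [d] become distinct powers of [t]. *)
Lemma mpoly_eq0_nat (K : numDomainType) (n : nat) (p : {mpoly K[n]}) :
  (forall v : 'I_n -> nat, p.@[fun i => (v i)%:R] = 0) -> p = 0.
Proof.
move=> p0; pose d := msize p; pose code (m : 'X_{1..n}) := (\sum_(i < n) m i * d ^ i)%N.
pose q : {poly K} := \sum_(m <- msupp p) p@_m *: 'X^(code m).
have q0 : q = 0.
  apply: poly_eq0_nat => t; rewrite -(p0 (fun i => t ^ (d ^ i))%N) mevalE horner_sum.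
  apply: eq_bigr => m _; rewrite hornerZ hornerXn; congr (_ * _).
  rewrite /code -prodrXr; apply: eq_bigr => i _.
  by rewrite natrX -exprM mulnC.
have code_inj : {in msupp p &, injective code}.
  move=> m m' mp mp' e; apply/mnmP; apply: (base_digits_inj (d := d)) e => i.
    by apply: leq_ltn_trans (msize_mdeg_lt mp); rewrite mdegE (bigD1 i) //= leq_addr.
  by apply: leq_ltn_trans (msize_mdeg_lt mp'); rewrite mdegE (bigD1 i) //= leq_addr.
apply/mpolyP => m; rewrite mcoeff0; apply/eqP; apply: contraT; rewrite -mcoeff_msupp => mp.
have /eqP := congr1 (fun r : {poly K} => r`_(code m)) q0.
rewrite coef0 coef_sum (bigD1_seq m) ?msupp_uniq //= coefZ coefXn eqxx mulr1.
rewrite big_seq_cond big1 ?addr0 => [|m' /andP[mp' ne]].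
  by move=> /eqP pm; move: mp; rewrite mcoeff_msupp pm eqxx.
rewrite coefZ coefXn; case: eqP => [e|_]; last by rewrite mulr0.
by move: ne; rewrite (code_inj _ _ mp mp' e) eqxx.
Qed.

(** The matrices 2 T^A are trace-dual to the generators, so on traceless matrices this inverts x |->
    sum of x_A T^A; scalar matrices get coordinates 0. *)
Definition coords (K : fieldType) (T : 'I_8 -> 'M[K]_3) (M : 'M[K]_3) (A : 'I_8) : K :=
  2%:R * \tr (T A *m M).

Lemma meval_genmx (K : fieldType) (T : 'I_8 -> 'M[K]_3) (x : 'I_8 -> K) :
  map_mx (meval x) (genmx T) = \sum_A x A *: T A.
Proof.
apply/matrixP => i j; rewrite !mxE summxE rmorph_sum; apply: eq_bigr => A _ /=.
by rewrite mevalZ mevalXU mxE mulrC.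
Qed.

Lemma meval_casimir2 (K : fieldType) (T : 'I_8 -> 'M[K]_3) (x : 'I_8 -> K) (M : 'M[K]_3) :
  \sum_A x A *: T A = M -> (casimir2 T).@[x] = \tr (M *m M).
Proof. by rewrite -meval_genmx => <-; rewrite -map_mxM trace_map_mx. Qed.

Lemma meval_casimir3 (K : fieldType) (T : 'I_8 -> 'M[K]_3) (x : 'I_8 -> K) (M : 'M[K]_3) :
  \sum_A x A *: T A = M -> (casimir3 T).@[x] = \tr (M *m M *m M).
Proof. by rewrite -meval_genmx => <-; rewrite -!map_mxM trace_map_mx. Qed.

Lemma sum_coords (K : numFieldType) (T : 'I_8 -> 'M[K]_3) (M : 'M[K]_3) :
  (forall A, \tr (T A) = 0) ->
  (forall A B, \tr (T A *m T B) = (A == B)%:R / 2%:R) ->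
  \tr M = 0 -> \sum_A coords T M A *: T A = M.
Proof.
move=> tr_gen tr_gen2 trM; have := fierz_mx tr_gen tr_gen2 idfun M.
rewrite trM mulr0 raddf0 subr0 /coords => e.
under eq_bigr do rewrite -scalerA.
rewrite -scaler_sumr; have -> : \sum_A \tr (T A *m M) *: T A = 2%:R^-1 *: M.
  by rewrite -e; apply: eq_bigr => A _; rewrite map_mx_id.
by rewrite scalerA divff ?scale1r // pnatr_eq0.
Qed.

Lemma coords_sum (K : numFieldType) (T : 'I_8 -> 'M[K]_3) (x : 'I_8 -> K) :
  (forall A B, \tr (T A *m T B) = (A == B)%:R / 2%:R) ->
  coords T (\sum_A x A *: T A) =1 x.
Proof.
move=> tr_gen2 A; rewrite /coords mulmx_sumr linear_sum (bigD1 A) //= big1 ?addr0.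
  by rewrite -scalemxAr mxtraceZ tr_gen2 eqxx mul1r; field.
move=> B /negbTE neBA; rewrite -scalemxAr mxtraceZ tr_gen2 eq_sym neBA.
by rewrite mul0r !mulr0.
Qed.

(** Newton's identities with vanishing first power sum. *)
Lemma mesym3 (K : fieldType) (v : 'I_3 -> K) : \sum_i v i = 0 ->
  [/\ (mesym 3 K 1).@[v] = 0, 2%:R * (mesym 3 K 2).@[v] = - \sum_i v i ^+ 2
    & 3%:R * (mesym 3 K 3).@[v] = \sum_i v i ^+ 3].
Proof.
pose i0 : 'I_3 := 0; pose i1 : 'I_3 := 1; pose i2 : 'I_3 := 2%:R.
have sum3 (F : 'I_3 -> K) : \sum_i F i = F i0 + F i1 + F i2.
  rewrite !big_ord_recl big_ord0 addr0 addrA.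
  by congr (F _ + F _ + F _); apply/val_inj.
have s1 : (mesym 3 K 1).@[v] = \sum_i v i.
  by rewrite mesym1E raddf_sum; apply: eq_bigr => i _; rewrite /= mevalXU.
have s3 : (mesym 3 K 3).@[v] = v i0 * v i1 * v i2.
  rewrite mesymnnE rmorph_prod /= !big_ord_recl big_ord0 mulr1 mulrA !mevalXU.
  by congr (v _ * v _ * v _); apply/val_inj.
have s2 : (mesym 3 K 2).@[v] = v i0 * v i1 + v i0 * v i2 + v i1 * v i2.
  (* By Vieta the second elementary symmetric polynomial is read off as the coefficient of X in the
     product of the X - v_i. *)
  have := mroots_coeff [tuple v i | i < 3] (Ordinal (isT : 2 < 4)%N).
  rewrite sqrrN expr1n mul1r (meval_eq _ (tnth_mktuple v)) => <- /=.
  rewrite big_map enumT -enumT big_enum /=.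
  have -> : \prod_i ('X - (v i)%:P) = 'X^3 - (v i0 + v i1 + v i2) *: 'X^2
      + (v i0 * v i1 + v i0 * v i2 + v i1 * v i2) *: 'X - (v i0 * v i1 * v i2)%:P.
    rewrite !big_ord_recl big_ord0 mulr1.
    have -> : lift ord0 (ord0 : 'I_2) = i1 by apply/val_inj.
    have -> : lift ord0 (lift ord0 (ord0 : 'I_1)) = i2 by apply/val_inj.
    by rewrite -!mul_polyC !(polyCD, polyCM); ring.
  by rewrite !(coefB, coefD, coefZ, coefXn, coefX, coefC) /=; ring.
rewrite s1 s2 s3 !sum3 => /eqP; rewrite addr_eq0 => /eqP v0.
have -> : v i2 = - (v i0 + v i1) by rewrite v0 opprK.
by split; ring.
Qed.

Lemma comp_mpolyX3 (K : fieldType) (n : nat) (x y : K) (a b : {mpoly K[n]}) (m : 'X_{1..3}) :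
  'X_[m] \mPo [tuple 0; x *: a; y *: b] =
  ((m 0 == 0%N)%:R * (x ^+ m 1 * y ^+ m 2%:R)) *: (a ^+ m 1 * b ^+ m 2%:R).
Proof.
rewrite comp_mpolyX !big_ord_recl big_ord0 mulr1.
have -> : lift ord0 (ord0 : 'I_2) = 1 by apply/val_inj.
have -> : lift ord0 (lift ord0 (ord0 : 'I_1)) = 2%:R by apply/val_inj.
rewrite /tnth /= !exprZn expr0n.
case: eqP => _; first by rewrite !mul1r -scalerAl -scalerAr scalerA.
by rewrite !mul0r scale0r.
Qed.

Section Chevalley.
Variables (C : numClosedFieldType) (T : 'I_8 -> 'M[C]_3) (f : {mpoly C[8]}).
Let adj (U : 'M[C]_3) : 'M[C]_3 := map_mx Num.conj U^T.
Hypothesis herm_gen : forall A, adj (T A) = T A.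
Hypothesis tr_gen : forall A, \tr (T A) = 0.
Hypothesis tr_gen2 : forall A B, \tr (T A *m T B) = (A == B)%:R / 2%:R.
Hypothesis f_inv : forall U M : 'M[C]_3, U *m adj U = 1%:M -> \det U = 1 ->
  f.@[coords T (adj U *m M *m U)] = f.@[coords T M].

(* Dividing by a cube root of the determinant makes a unitary matrix special and
   does not change the conjugation. *)
Lemma unitary_invariant (U M : 'M[C]_3) : U *m adj U = 1%:M ->
  f.@[coords T (adj U *m M *m U)] = f.@[coords T M].
Proof.
move=> unU; pose c := 3.-root (\det U).
have c3 : c ^+ 3 = \det U by rewrite rootCK.
have cc : c * Num.conj c = 1.
  have c2_ge0 : 0 <= c * Num.conj c by rewrite mul_conjC_ge0.
  apply/eqP; rewrite -(pexpr_eq1 (n := 3)) // exprMn -rmorphXn c3 /=.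
  by rewrite -det_tr -det_map_mx det_tr -det_mulmx unU det1.
have c0 : c != 0 by apply: contra_eq_neq cc => ->; rewrite mul0r eq_sym oner_eq0.
have adjZ : adj (c^-1 *: U) = Num.conj c^-1 *: adj U by apply/matrixP => i j; rewrite !mxE rmorphM.
have ccV : Num.conj c^-1 * c^-1 = 1 by rewrite fmorphV -invfM mulrC cc invr1.
rewrite -[RHS](f_inv (U := c^-1 *: U)).
- by rewrite adjZ -!scalemxAl -scalemxAr scalerA ccV scale1r.
- by rewrite adjZ -scalemxAl -scalemxAr scalerA mulrC ccV scale1r.
- by rewrite detZ exprVn c3 mulVf // -c3 expf_neq0.
Qed.

(** The restriction of [f] to diagonal matrices. The three entries stay independent, without a trace
    condition, so that the theorem on symmetric polynomials applies. *)
Let g : {mpoly C[3]} :=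
  f \mPo [tuple \sum_(i < 3) (2%:R * T A i i) *: 'X_i | A < 8].

Lemma meval_restriction (v : 'I_3 -> C) :
  g.@[v] = f.@[coords T (diag_mx (\row_i v i))].
Proof.
rewrite comp_mpoly_meval; apply: meval_eq => A; rewrite tnth_mktuple rmorph_sum /coords.
rewrite /mxtrace mulr_sumr; apply: eq_bigr => i _ /=.
by rewrite mevalZ mevalXU mul_mx_diag !mxE mulrA.
Qed.

(** Permuting the diagonal is conjugation by a permutation matrix; its determinant may be -1, which
    is why invariance under all unitary matrices is used. *)
Lemma restriction_sym : g \is symmetric.
Proof.
apply/issymP => s; apply/eqP; rewrite -subr_eq0; apply/eqP/mpoly_eq0_nat => k.
pose v i : C := (k i)%:R; rewrite -/v mevalB; apply/eqP; rewrite subr_eq0; apply/eqP.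
have -> : (msym s g).@[v] = g.@[fun i => v (s i)].
  rewrite -[msym s g]comp_mpoly_id msym_mPo comp_mpoly_meval; apply: meval_eq => i.
  by rewrite !tnth_mktuple mevalXU.
rewrite !meval_restriction.
have adj_perm : adj (perm_mx s^-1) = perm_mx s.
  by rewrite /adj tr_perm_mx invgK map_perm_mx.
rewrite -[RHS](unitary_invariant (U := perm_mx s^-1)); last first.
  by rewrite adj_perm -perm_mxM mulVg perm_mx1.
congr (_.@[coords T _]); rewrite adj_perm -row_permE -col_permE.
apply/matrixP => i j; by rewrite !mxE (inj_eq perm_inj).
Qed.

(** On eigenvalues with sum 0 the elementary symmetric functions are 0, -p2/2 and p3/3, by Newton's
    identities. *)
Lemma invariant_poly :
  f = symf g \mPo [tuple 0; - 2%:R^-1 *: casimir2 T; 3%:R^-1 *: casimir3 T].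
Proof.
apply/eqP; rewrite -subr_eq0; apply/eqP/mpoly_eq0_nat => k.
pose x A : C := (k A)%:R; rewrite -/x mevalB; apply/eqP; rewrite subr_eq0; apply/eqP.
pose M := \sum_A x A *: T A.
(* Natural coordinates are real, so the Hermitian generators give a Hermitian combination. *)
have Mherm : M \is hermsymmx.
  rewrite is_hermitianmxE expr0 scale1r; apply/eqP; rewrite /M.
  rewrite linear_sum map_mx_sum; apply: eq_bigr => A _.
  apply/matrixP => i j; rewrite /= !mxE rmorphM /= conjC_nat.
  by have /matrixP/(_ i j) := herm_gen A; rewrite !mxE => ->.
have /orthomx_spectralP := hermitian_normalmx Mherm.
move: (spectralmx M) (spectral_diag M) (spectral_unitarymx M) => P sp Pun eM.
have PPV : invmx P = adj P by rewrite invmx_unitary.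
have trM : \tr M = 0.
  by rewrite /M linear_sum big1 // => A _; rewrite linearZ /= tr_gen mulr0.
pose v i := sp 0 i.
have diagE : diag_mx sp = diag_mx (\row_i v i).
  by congr diag_mx; apply/rowP => i; rewrite mxE.
have tr_conj (D : 'M[C]_3) : \tr (invmx P *m D *m P) = \tr D.
  by rewrite mxtrace_mulC mulmxA mulmxV ?mul1mx // unitarymx_unit.
have conjM (D E : 'M[C]_3) : invmx P *m D *m P *m (invmx P *m E *m P) = invmx P *m (D *m E) *m P.
  by rewrite !mulmxA mulmxK // unitarymx_unit.
have sumv : \sum_i v i = 0 by rewrite -[RHS]trM eM tr_conj mxtrace_diag.
have fx : f.@[x] = g.@[v].
  (* Conjugation by the diagonalizing unitary matrix does not change the value of [f]. *)
  rewrite meval_restriction -diagE -(unitary_invariant (U := P)) //; last exact/unitarymxP.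
  by rewrite -PPV -eM; apply: meval_eq => A; rewrite coords_sum.
have [s1 s2 s3] := mesym3 sumv.
rewrite fx [in LHS](symfP restriction_sym) !comp_mpoly_meval; apply: meval_eq => i.
rewrite tnth_mktuple.
have e2 : (casimir2 T).@[x] = \sum_i v i ^+ 2.
  rewrite (meval_casimir2 (M := M)) // eM conjM tr_conj mulmx_diag mxtrace_diag.
  by apply: eq_bigr => j _; rewrite mxE expr2.
have e3 : (casimir3 T).@[x] = \sum_i v i ^+ 3.
  rewrite (meval_casimir3 (M := M)) // eM !conjM tr_conj !mulmx_diag mxtrace_diag.
  by apply: eq_bigr => j _; rewrite !mxE exprS expr2 mulrA.
case: i => [[|[|[|//]]] lt_i] /=; rewrite /tnth /=.
- by rewrite meval0.
- by rewrite mevalZ e2 mulNr -mulrN -s2 mulrA mulVf ?mul1r // pnatr_eq0.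
- by rewrite mevalZ e3 -s3 mulrA mulVf ?mul1r // pnatr_eq0.
Qed.

Lemma invariant_span_ind (Q : {mpoly C[8]} -> Prop) :
  Q 0 -> (forall p q, Q p -> Q q -> Q (p + q)) -> (forall c p, Q p -> Q (c *: p)) ->
  (forall j k, Q (casimir2 T ^+ j * casimir3 T ^+ k)) -> Q f.
Proof.
move=> Q0 QD QZ Qjk; rewrite invariant_poly comp_mpolyEX.
elim/big_ind: _ => // m _; apply: (QZ).
rewrite comp_mpolyX3.
exact: QZ (Qjk _ _).
Qed.

End Chevalley.

(** * Linear independence of the products p2^n h_k *)

Lemma graded_poly_indep (S : idomainType) (P : nat -> {poly S}) (q : nat -> S) (n : nat) :
  (forall k, size (P k) = k.+1) -> \sum_(k < n) q k *: P k = 0 ->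
  forall k, (k < n)%N -> q k = 0.
Proof.
move=> sP; elim: n => [//|n IHn]; rewrite big_ord_recr /= => e.
have qn : q n = 0.
  have /eqP := congr1 (fun p : {poly S} => p`_n) e.
  rewrite coefD coef_sum big1 => [|k _]; last by rewrite coefZ nth_default ?mulr0 ?sP.
  rewrite add0r coefZ coef0 mulf_eq0 => /orP[/eqP // |].
  have -> : (P n)`_n = lead_coef (P n) by rewrite lead_coefE sP.
  by rewrite lead_coef_eq0 -size_poly_eq0 sP.
move: e; rewrite qn scale0r addr0 => /IHn q0 k.
by rewrite ltnS leq_eqVlt => /predU1P[-> //|/q0].
Qed.

Lemma mevalXnM (K : comNzRingType) (n : nat) (x : 'I_n -> K) (p q : {mpoly K[n]}) (j k : nat) :
  (p ^+ j * q ^+ k).@[x] = p.@[x] ^+ j * q.@[x] ^+ k.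
Proof. by rewrite mevalM !rmorphXn. Qed.

Section Independence.
Variables (C : numClosedFieldType) (T : 'I_8 -> 'M[C]_3).
Hypothesis tr_gen : forall A, \tr (T A) = 0.
Hypothesis tr_gen2 : forall A B, \tr (T A *m T B) = (A == B)%:R / 2%:R.

(* The entries of a traceless diagonal matrix with prescribed invariants are the
   roots of a depressed cubic. *)
Lemma casimirs_surj (a b : C) :
  exists x, (casimir2 T).@[x] = a /\ (casimir3 T).@[x] = b.
Proof.
(* The coefficients encode e1 = 0, e2 = -a/2 and e3 = b/3. *)
pose p : {poly C} := 'X^3 + (- (a / 2%:R)) *: 'X - (b / 3%:R)%:P.
have cp i : p`_i = (i == 3)%:R + (- (a / 2%:R)) * (i == 1)%:R - (b / 3%:R) * (i == 0)%:R.
  by rewrite coefB coefD coefXn coefZ coefX coefC; case: i => [|i] /=; rewrite ?mulr1 ?mulr0.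
have sp : size p = 4.
  apply/eqP; rewrite eqn_leq; apply/andP; split.
    by apply/leq_sizeP => -[|[|[|[|j]]]] // _; rewrite cp /=; ring.
  rewrite ltnNge; apply/negP => /leq_sizeP/(_ 3 isT)/eqP; rewrite cp /=.
  by rewrite !mulr0 subr0 addr0 oner_eq0.
have [r pE] := closed_field_poly_normal p.
have lc : lead_coef p = 1 by rewrite lead_coefE sp cp /=; ring.
rewrite lc scale1r in pE.
have := size_prod_XsubC r idfun; rewrite /= -pE sp => -[].
case: r pE => [|x [|y [|z [|]]]] // pE _.
have pE' : p = 'X^3 - (x + y + z) *: 'X^2 + (x * y + x * z + y * z) *: 'X - (x * y * z)%:P.
  rewrite pE !big_cons big_nil mulr1.
  by rewrite -!mul_polyC !(polyCD, polyCM); ring.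
have ce i : p`_i = (i == 3)%:R - (x + y + z) * (i == 2)%:R + (x * y + x * z + y * z) * (i == 1)%:R
     - (x * y * z) * (i == 0)%:R.
  rewrite pE' coefB coefD coefB !coefZ !coefXn coefX coefC.
  by case: i => [|i] /=; rewrite ?mulr1 ?mulr0.
have e2 := ce 2; have e1 := ce 1; have e0 := ce 0; rewrite !cp /= in e2 e1 e0.
have xyz : x + y + z = 0.
  apply: oppr_inj; rewrite oppr0.
  transitivity (0 - (x + y + z) * 1 + (x * y + x * z + y * z) * 0 - x * y * z * 0).
    by ring.
  by rewrite -e2; ring.
have zE : z = - (x + y) by rewrite -[LHS](addKr (x + y)) xyz addr0.
pose d : 'rV[C]_3 := \row_i nth 0 [:: x; y; z] i.
pose M := diag_mx d.
have sum3 (F : C -> C) : \sum_i F (d 0 i) = F x + F y + F z.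
  by rewrite !big_ord_recl big_ord0 addr0 addrA !mxE.
have trM : \tr M = 0 by rewrite mxtrace_diag (sum3 id) /= xyz.
exists (coords T M); split.
  rewrite (meval_casimir2 (sum_coords tr_gen tr_gen2 trM)) mulmx_diag mxtrace_diag.
  under eq_bigr do rewrite mxE; rewrite (sum3 (fun t => t * t)).
  have -> : a = - 2%:R * (0 + (- (a / 2%:R)) * 1 - b / 3%:R * 0) by field.
  by rewrite e1 zE; ring.
rewrite (meval_casimir3 (sum_coords tr_gen tr_gen2 trM)) !mulmx_diag mxtrace_diag.
rewrite (eq_bigr (fun i => d 0 i * d 0 i * d 0 i)) => [|i _]; last by rewrite 2!mxE.
rewrite (sum3 (fun t => t * t * t)).
have -> : b = - 3%:R * (0 + (- (a / 2%:R)) * 0 - b / 3%:R * 1) by field.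
by rewrite e0 zE; ring.
Qed.

(** The values of p2 and p3 can be prescribed independently. With p2 = a fixed, h_k is a polynomial
    of degree exactly k in p3, which separates the indices k; varying a then separates the n. *)
Lemma casimir_harmonic_indep (c : nat -> nat -> C) (m d : nat) :
  \sum_(k < m) \sum_(n < d) c k n *: (casimir2 T ^+ n * harmonic T k) = 0 ->
  forall k n, (k < m)%N -> (n < d)%N -> c k n = 0.
Proof.
move=> e.
pose H a k : {poly C} := \sum_(t < k./2.+1) (harm_coef C k t * a ^+ (3 * t)) *: 'X^(k - 2 * t).
have sH a k : size (H a k) = k.+1.
  rewrite /H big_ord_recl /= muln0 expr0 muln0 subn0 mulr1.
  have -> : harm_coef C k 0 = 1.
    by rewrite /harm_coef expr0 invr1 mul1r muln0 !subn0 fact0 mul1n divff // natr_fact_neq0.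
  rewrite scale1r size_polyDl size_polyXn // ltnS.
  apply/leq_sizeP => j le_kj; rewrite coef_sum big1 // => t _.
  rewrite coefZ coefXn; case: eqP => [ej|]; last by rewrite mulr0.
  have := ltn_ord t; have := odd_double_half k.
  by move: ej; rewrite /= /bump /= add1n; lia.
have ek a k : (k < m)%N -> \sum_(n < d) c k n * a ^+ n = 0.
  move: k; apply: (graded_poly_indep (q := fun k => \sum_(n < d) c k n * a ^+ n) (sH a)).
  apply: poly_eq0_nat => b; have [x [x2 x3]] := casimirs_surj a b%:R.
  have /(congr1 (meval x)) := e; rewrite raddf_sum meval0 horner_sum => e'.
  rewrite -[RHS]e'; apply: eq_bigr => k _ /=.
  rewrite hornerZ mulr_suml [in RHS]raddf_sum; apply: eq_bigr => n _ /=.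
  rewrite mevalZ mevalM rmorphXn /= x2 -mulrA; congr (_ * (_ * _)).
  rewrite /harmonic [in RHS]raddf_sum horner_sum; apply: eq_bigr => t _ /=.
  by rewrite mevalZ mevalXnM x2 x3 hornerZ hornerXn mulrA.
move=> k n lt_k; move: n.
apply: (graded_poly_indep (P := fun n => 'X^n) (q := c k)) => [n|]; first by rewrite size_polyXn.
apply: poly_eq0_nat => a; rewrite -(ek a%:R k lt_k) horner_sum.
by apply: eq_bigr => n _; rewrite hornerZ hornerXn.
Qed.

End Independence.

(** * Eigenvectors of the cut Hamiltonian *)

(** The finite sum fails to be an eigenvector only through two boundary terms: one carries the first
    omitted value L (d + 1), the other sits at the first omitted power of p2. *)
Lemma diff_ham_sonine_sum (K : numFieldType) (T : 'I_8 -> 'M[K]_3) (k : nat) (x : K)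
    (L : nat -> K) (d : nat) :
  (forall A, \tr (T A) = 0) ->
  (forall A B, \tr (T A *m T B) = (A == B)%:R / 2%:R) ->
  (3 * k + 4)%:R * L 1 = ((3 * k + 4)%:R - x) * L 0 ->
  (forall n, (n.+2 * (n + 3 * k + 5))%:R * L n.+2 =
    ((2 * n + 3 * k + 6)%:R - x) * L n.+1 - L n) ->
  diff_ham T (\sum_(n < d.+1) L n *: (casimir2 T ^+ n * harmonic T k)) =
  (x / 2%:R) *: (\sum_(n < d.+1) L n *: (casimir2 T ^+ n * harmonic T k))
  + ((d.+1 * (d + 3 * k + 4))%:R / 2%:R * L d.+1) *: (casimir2 T ^+ d * harmonic T k)
  - (2%:R^-1 * L d) *: (casimir2 T ^+ d.+1 * harmonic T k).
Proof.
move=> tr_gen tr_gen2 rec0 recS; pose P n := casimir2 T ^+ n * harmonic T k.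
have hamP n : diff_ham T (P n) = ((2 * n + 3 * k + 4)%:R / 2%:R) *: P n
  - 2%:R^-1 *: P n.+1 - ((n * (n + 3 + 3 * k))%:R / 2%:R) *: P n.-1.
  exact: diff_ham_casimir2X_harmonic.
have sumE m : \sum_(n < m) L n *: (casimir2 T ^+ n * harmonic T k) = \sum_(n < m) L n *: P n by [].
rewrite sumE -/(P d) -/(P d.+1) {sumE}; move: P hamP => P hamP.
elim: d => [|d IHd].
  rewrite !big_ord1 diff_hamZ hamP mul0n mul0r scale0r subr0 scalerBr !scalerA muln0 add0n.
  rewrite -scalerDl [L 0 * 2%:R^-1]mulrC; congr (_ *: _ - _).
  by rewrite /= mul1n [_ * L 1]mulrAC rec0; field.
rewrite big_ord_recr diff_hamD IHd diff_hamZ hamP /= !(scalerDr, scalerN, scalerA).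
have -> : (d.+1 * (d.+1 + 3 + 3 * k))%:R = (d.+1 * (d + 3 * k + 4))%:R :> K.
  by congr (_%:R); lia.
have -> : (d.+2 * (d.+1 + 3 * k + 4))%:R / 2%:R * L d.+2 =
    (((2 * d + 3 * k + 6)%:R - x) * L d.+1 - L d) / 2%:R.
  by rewrite -recS mulrAC; congr (_%:R * _ / _); lia.
have -> : (2 * d.+1 + 3 * k + 4)%:R = (2 * d + 3 * k + 6)%:R :> K by congr (_%:R); lia.
rewrite [L d.+1 * ((d.+1 * _)%:R / _)]mulrC [L d.+1 * 2%:R^-1]mulrC.
set S := _ *: \sum_(i < d.+1) _; set Z := _ *: P d; set W := _ *: P d.+2.
(* The recurrence splits the diagonal term of the new summand into the part cancelling the old upper
   boundary term, the eigenvalue part, and the new boundary coefficient. *)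
have -> : (L d.+1 * ((2 * d + 3 * k + 6)%:R / 2%:R)) *: P d.+1 =
  (2%:R^-1 * L d) *: P d.+1 + (x / 2%:R * L d.+1) *: P d.+1
  + ((((2 * d + 3 * k + 6)%:R - x) * L d.+1 - L d) / 2%:R) *: P d.+1.
  by rewrite -!scalerDl; congr (_ *: _); field.
by ring.
Qed.

(** * Truncation and gauge action *)

Section CutProj.
Variables (R : rcfType) (N : nat).

Lemma mcoeff_cut_proj (f : fock R) (m : 'X_{1..8}) :
  (cut_proj N f)@_m = if (mdeg m <= N)%N then f@_m else 0.
Proof.
rewrite /cut_proj raddf_sum /= big_mkcond.
transitivity (\sum_(m' <- msupp f) if (mdeg m <= N)%N then (f@_m' *: 'X_[m'])@_m else 0).
  apply: eq_bigr => m' _; rewrite mcoeffZ mcoeffX.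
  by case: eqP => [->//|_]; rewrite mulr0 !if_same.
by case: ifP => _; [rewrite [in RHS](mpolyE f) raddf_sum | rewrite big1].
Qed.

Lemma cut_projD (f g : fock R) : cut_proj N (f + g) = cut_proj N f + cut_proj N g.
Proof.
apply/mpolyP => m; rewrite mcoeffD !mcoeff_cut_proj mcoeffD.
by case: ifP => // _; rewrite addr0.
Qed.

Lemma cut_projZ (c : R[i]) (f : fock R) : cut_proj N (c *: f) = c *: cut_proj N f.
Proof.
apply/mpolyP => m; rewrite mcoeffZ !mcoeff_cut_proj mcoeffZ.
by case: ifP => // _; rewrite mulr0.
Qed.

Lemma cut_proj_id (f : fock R) : (msize f <= N.+1)%N -> cut_proj N f = f.
Proof.
move=> sf; apply/mpolyP => m; rewrite mcoeff_cut_proj; case: leqP => // lt_Nm.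
by rewrite memN_msupp_eq0 // msize_mdeg_ge // (leq_trans sf).
Qed.

Lemma cut_proj_homog (d : nat) (f : fock R) : f \is d.-homog ->
  cut_proj N f = if (d <= N)%N then f else 0.
Proof.
move=> fd; apply/mpolyP => m; rewrite mcoeff_cut_proj.
have [->|nmd] := eqVneq (mdeg m) d; first by case: ifP => // _; rewrite mcoeff0.
rewrite (dhomog_nemf_coeff fd nmd) !if_same.
by case: ifP; rewrite ?mcoeff0 ?(dhomog_nemf_coeff fd nmd).
Qed.

End CutProj.

Section AdjointAction.
Variables (K : numFieldType) (T : 'I_8 -> 'M[K]_3) (U V : 'M[K]_3).
Hypothesis tr_gen : forall A, \tr (T A) = 0.
Hypothesis tr_gen2 : forall A B, \tr (T A *m T B) = (A == B)%:R / 2%:R.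
Hypothesis VU : V *m U = 1%:M.
Let ad := [tuple \sum_(A < 8)
  (2%:R * \tr (T A *m (U *m T B *m V))) *: ('X_A : {mpoly K[8]}) | B < 8].

(** By completeness, substituting the adjoint representation matrix into the variables amounts to
    conjugating the matrix whose coordinates are inserted. *)
Lemma meval_adjoint (M : 'M[K]_3) (f : {mpoly K[8]}) :
  (f \mPo ad).@[coords T M] = f.@[coords T (V *m M *m U)].
Proof.
rewrite comp_mpoly_meval; apply: meval_eq => B; rewrite tnth_mktuple rmorph_sum /=.
transitivity (4%:R * \sum_A \tr (T A *m (U *m T B *m V)) * \tr (T A *m M)).
  rewrite mulr_sumr; apply: eq_bigr => A _; rewrite mevalZ mevalXU /coords.
  by rewrite mulrACA -natrM.
have := fierz_tr tr_gen tr_gen2 idfun (U *m T B *m V) M.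
under eq_bigr do rewrite map_mx_id //.
move=> ->; have -> : \tr (U *m T B *m V) = 0 by rewrite mxtrace_mulC mulmxA VU mul1mx tr_gen.
have -> : \tr (U *m T B *m V *m M) = \tr (T B *m (V *m M *m U)).
  by rewrite mxtrace_mulC !mulmxA [RHS]mxtrace_mulC !mulmxA [RHS]mxtrace_mulC !mulmxA.
by rewrite /coords /= mulr0 mul0r subr0 mulrA; congr (_ * _); field.
Qed.

Lemma adjoint_invP (f : {mpoly K[8]}) :
  (forall M, \tr M = 0 -> f.@[coords T (V *m M *m U)] = f.@[coords T M]) ->
  f \mPo ad = f.
Proof.
move=> f_inv; apply/eqP; rewrite -subr_eq0; apply/eqP/mpoly_eq0_nat => k.
rewrite mevalB; apply/eqP; rewrite subr_eq0; apply/eqP.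
pose M := \sum_A (k A)%:R *: T A.
have xE : coords T M =1 (fun A => (k A)%:R) by exact: coords_sum.
rewrite -!(meval_eq _ xE) meval_adjoint // f_inv //.
by rewrite /M linear_sum big1 // => A _; rewrite /= mxtraceZ tr_gen mulr0.
Qed.

Lemma adjoint_casimirs (j k : nat) :
  (casimir2 T ^+ j * casimir3 T ^+ k) \mPo ad = casimir2 T ^+ j * casimir3 T ^+ k.
Proof.
apply: adjoint_invP => M trM.
have UV : U *m V = 1%:M by exact: mulmx1C.
have trN : \tr (V *m M *m U) = 0 by rewrite mxtrace_mulC mulmxA UV mul1mx.
have VMU (M1 M2 : 'M[K]_3) : V *m M1 *m U *m (V *m M2 *m U) = V *m (M1 *m M2) *m U.
  by rewrite !mulmxA -[V *m M1 *m U *m V]mulmxA UV mulmx1.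
have trVU (M1 : 'M[K]_3) : \tr (V *m M1 *m U) = \tr M1.
  by rewrite mxtrace_mulC mulmxA UV mul1mx.
have e2 := meval_casimir2 (sum_coords tr_gen tr_gen2 trM).
have e3 := meval_casimir3 (sum_coords tr_gen tr_gen2 trM).
have e2' := meval_casimir2 (sum_coords tr_gen tr_gen2 trN).
have e3' := meval_casimir3 (sum_coords tr_gen tr_gen2 trN).
rewrite !mevalXnM; congr (_ ^+ _ * _ ^+ _).
  by apply: etrans e2' _; apply: etrans _ (esym e2); rewrite VMU trVU.
by apply: etrans e3' _; apply: etrans _ (esym e3); rewrite !VMU trVU.
Qed.

End AdjointAction.

Section InvSpace.
Variables (R : rcfType) (T : 'I_8 -> 'M[R[i]]_3) (N : nat).
Hypothesis hT : su3_generators T.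

Let herm_gen A : adjmx (T A) = T A. Proof. by case: hT. Qed.
Let tr_gen A : \tr (T A) = 0. Proof. by case: hT. Qed.
Let tr_gen2 A B : \tr (T A *m T B) = (A == B)%:R / 2%:R. Proof. by case: hT. Qed.

Lemma in_SU3_adjK (U : 'M[R[i]]_3) : in_SU3 U -> adjmx U *m U = 1%:M.
Proof. by case=> /mulmx1C. Qed.

Lemma inv_space0 : inv_space T N 0.
Proof. by split=> [|U _]; [rewrite msize0 | exact: comp_mpoly0]. Qed.

Lemma inv_spaceD (f g : fock R) : inv_space T N f -> inv_space T N g -> inv_space T N (f + g).
Proof.
move=> [sf f_inv] [sg g_inv]; split=> [|U SU].
  by rewrite (leq_trans (msizeD_le _ _)) // geq_max sf.
by rewrite /gauge_act comp_mpolyD; congr (_ + _); [exact: f_inv | exact: g_inv].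
Qed.

Lemma inv_spaceZ (c : R[i]) (f : fock R) : inv_space T N f -> inv_space T N (c *: f).
Proof.
move=> [sf f_inv]; split=> [|U SU]; first exact: leq_trans (msizeZ_le _ _) sf.
by rewrite /gauge_act comp_mpolyZ; congr (_ *: _); exact: f_inv.
Qed.

Lemma inv_space_casimir (j k : nat) : (2 * j + 3 * k <= N)%N ->
  inv_space T N (casimir2 T ^+ j * casimir3 T ^+ k).
Proof.
move=> le_N; split=> [|U SU]; last exact: (adjoint_casimirs tr_gen tr_gen2 (in_SU3_adjK SU)).
rewrite msizeE; apply/bigmax_leqP_seq => m mf _; rewrite ltnS.
by rewrite (dhomog_mf (casimir_homog T j k) mf).
Qed.

(** Truncation fixes [f], and it keeps or kills each homogeneous product of Casimirs. Applying the
    unbounded principle to the truncated polynomial therefore supplies the degree bound. *)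
Lemma inv_space_span_ind (Q : fock R -> Prop) :
  Q 0 -> (forall p q, Q p -> Q q -> Q (p + q)) -> (forall c p, Q p -> Q (c *: p)) ->
  (forall j k, (2 * j + 3 * k <= N)%N -> Q (casimir2 T ^+ j * casimir3 T ^+ k)) ->
  forall f, inv_space T N f -> Q f.
Proof.
move=> Q0 QD QZ Qjk f [sf f_inv]; rewrite -(cut_proj_id sf).
have f_inv' (U M : 'M[R[i]]_3) : U *m adjmx U = 1%:M -> \det U = 1 ->
    f.@[coords T (adjmx U *m M *m U)] = f.@[coords T M].
  move=> unU detU; have SU : in_SU3 U by [].
  rewrite -(meval_adjoint tr_gen tr_gen2 (in_SU3_adjK SU)).
  by congr (_.@[_]); exact: f_inv.
apply: (invariant_span_ind herm_gen tr_gen tr_gen2 f_inv' (Q := fun p => Q (cut_proj N p))).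
- by rewrite cut_proj_id ?msize0.
- by move=> p q Qp Qq; rewrite cut_projD; exact: QD.
- by move=> c p Qp; rewrite cut_projZ; exact: QZ.
- move=> j k; rewrite (cut_proj_homog N (casimir_homog T j k)).
  by case: ifP => // le_N; exact: Qjk.
Qed.

End InvSpace.

(** * Bases and inversion of evaluation *)

(** Replaces coefficients attached to positions in a list by coefficients attached to labels, so
    that sums can be reorganized by level and root. *)
Lemma is_basis_map (K : fieldType) (V : lmodType K) (W : V -> Prop) (I : eqType)
    (r : seq I) (F : I -> V) : uniq r ->
  (forall i, i \in r -> W (F i)) ->
  (forall c : I -> K, \sum_(i <- r) c i *: F i = 0 -> forall i, i \in r -> c i = 0) ->
  (forall v, W v -> exists c : I -> K, v = \sum_(i <- r) c i *: F i) ->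
  is_basis W (map F r).
Proof.
move=> ur WF indep span.
have sumE (g : nat -> K) :
    \sum_(o < size (map F r)) g o *: (map F r)`_o = \sum_(i <- r) g (index i r) *: F i.
  case: r ur {WF indep span} => [|i0 r0 ur]; first by rewrite big_nil big_ord0.
  rewrite -(big_mkord predT (fun o => g o *: (map F (i0 :: r0))`_o)) size_map.
  rewrite (big_nth i0) !big_nat; apply: eq_bigr => j /andP[_ lt_j].
  by rewrite index_uniq // (nth_map i0).
split=> [v /mapP[i ri ->]|c|v /span[c ->]]; first exact: WF.
- case: r ur c indep sumE {WF span} => [_ c _ _ _ []//|i0 r0]; set r := i0 :: r0.
  move=> ur c indep sumE e; pose cn j := if insub j is Some o then c o else 0.
  have cnE o : cn (val o) = c o by rewrite /cn valK.
  have e' : \sum_(i <- r) cn (index i r) *: F i = 0.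
    by rewrite -sumE -[RHS]e; apply: eq_bigr => o _; rewrite cnE.
  move=> o; have lt_o : (val o < size r)%N by have := ltn_ord o; rewrite {2}size_map.
  by rewrite -cnE -[val o](index_uniq i0 lt_o ur); apply: (indep _ e'); rewrite mem_nth.
- case: r ur sumE {WF indep span} => [|i0 r0 ur sumE].
    by exists (fun=> 0); rewrite big_nil big_ord0.
  exists (fun o => c (nth i0 (i0 :: r0) o)).
  rewrite (sumE (fun j => c (nth i0 (i0 :: r0) j))) !big_seq.
  by apply: eq_bigr => i ri; rewrite nth_index.
Qed.

(* [D] is the inverse of the square matrix [(P n).[x]]. *)
Lemma graded_poly_dual (K : fieldType) (P : nat -> {poly K}) (r : seq K) :
  (forall n, size (P n) = n.+1) -> uniq r ->
  exists D : nat -> K -> K,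
    (forall x y, x \in r -> y \in r ->
      \sum_(n < size r) (P n).[x] * D n y = (x == y)%:R) /\
    (forall m n, (m < size r)%N -> (n < size r)%N ->
      \sum_(x <- r) D m x * (P n).[x] = (m == n)%:R).
Proof.
move=> sP ur; pose M : 'M[K]_(size r) := \matrix_(i, n) (P n).[r`_i].
have Mu : M \in unitmx.
  (* A kernel vector would give a combination of degree below the number of nodes that vanishes at
     all of them. *)
  rewrite unitmxE unitfE -det_tr; apply/negP => /det0P[v v0 /rowP vM].
  pose vn j := if insub j is Some o then v 0 o else 0.
  have vnE (o : 'I_(size r)) : vn o = v 0 o by rewrite /vn valK.
  case/negP: v0; apply/eqP/rowP => o; rewrite mxE -vnE.
  apply: (graded_poly_indep (q := vn) (n := size r) sP) => //.
  apply: (@roots_geq_poly_eq0 _ _ r) => //.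
    apply/allP => x xr; have lt_x : (index x r < size r)%N by rewrite index_mem.
    have := vM (Ordinal lt_x); rewrite !mxE => e; apply/eqP; rewrite -e horner_sum.
    by apply: eq_bigr => n _; rewrite hornerZ vnE !mxE nth_index.
  apply: leq_trans (size_sum _ _ _) _; apply/bigmax_leqP => n _.
  by rewrite (leq_trans (size_scale_leq _ _)) // sP.
pose N := invmx M.
pose D n x := if (insub n, insub (index x r)) is (Some i, Some j) then N i j else 0.
have DE (n : 'I_(size r)) x (lt_x : (index x r < size r)%N) : D n x = N n (Ordinal lt_x).
  by rewrite /D valK insubT.
exists D; split=> [x y xr yr|m n lt_m lt_n].
  have lt_x : (index x r < size r)%N by rewrite index_mem.
  have lt_y : (index y r < size r)%N by rewrite index_mem.
  have /matrixP/(_ (Ordinal lt_x) (Ordinal lt_y)) := mulmxV Mu.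
  rewrite !mxE -(inj_eq val_inj) /= => e.
  have -> : (x == y) = (index x r == index y r).
    by apply/eqP/eqP => [->//|ei]; rewrite -(nth_index 0 xr) ei nth_index.
  by rewrite -e; apply: eq_bigr => n _; rewrite mxE /= nth_index // DE.
have /matrixP/(_ (Ordinal lt_m) (Ordinal lt_n)) := mulVmx Mu.
rewrite !mxE -(inj_eq val_inj) /= => <-.
rewrite (big_nth 0) big_mkord; apply: eq_bigr => i _; rewrite mxE /=; congr (_ * _).
have lt_i : (index (r`_i)%R r < size r)%N by rewrite index_uniq.
rewrite -[m]/(val (Ordinal lt_m)) DE; congr (N _ _); apply/val_inj.
by rewrite /= index_uniq.
Qed.

(** * The eigenvectors of both families *)

Lemma casimir2X_harmonic (K : fieldType) (T : 'I_8 -> 'M[K]_3) (n k : nat) :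
  casimir2 T ^+ n * harmonic T k =
  \sum_(t < k./2.+1) harm_coef K k t *: (casimir2 T ^+ (n + 3 * t) * casimir3 T ^+ (k - 2 * t)).
Proof.
rewrite /harmonic mulr_sumr; apply: eq_bigr => t _.
by rewrite -scalerAr exprD -mulrA.
Qed.

Lemma harm_coef0 (K : numFieldType) (k : nat) : harm_coef K k 0 = 1.
Proof.
by rewrite /harm_coef expr0 invr1 mul1r muln0 !subn0 fact0 mul1n divff // natr_fact_neq0.
Qed.

Lemma Gamma_evenE (R : rcfType) (kappa t : nat) : (t <= kappa)%N ->
  (Gamma_even R kappa (kappa - t))%:C%C = harm_coef R[i] (2 * kappa) t.
Proof.
move=> le_t; rewrite /Gamma_even /harm_coef.
have -> : (kappa - t)%N%:Z - kappa%:Z = - t%:Z by lia.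
have -> : (kappa + (kappa - t) = 2 * kappa - t)%N by lia.
have -> : (kappa - (kappa - t) = t)%N by lia.
have -> : (2 * (kappa - t) = 2 * kappa - 2 * t)%N by lia.
by rewrite -exprnN !(rmorphM, fmorphV, rmorphXn, rmorphN, rmorph_nat).
Qed.

Lemma Gamma_oddE (R : rcfType) (kappa t : nat) : (t <= kappa)%N ->
  (Gamma_odd R kappa (kappa - t))%:C%C = harm_coef R[i] (2 * kappa + 1) t.
Proof.
move=> le_t; rewrite /Gamma_odd /harm_coef.
have -> : (kappa - t)%N%:Z - kappa%:Z = - t%:Z by lia.
have -> : (kappa + (kappa - t) + 1 = 2 * kappa + 1 - t)%N by lia.
have -> : (kappa - (kappa - t) = t)%N by lia.
have -> : (2 * (kappa - t) + 1 = 2 * kappa + 1 - 2 * t)%N by lia.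
by rewrite -exprnN !(rmorphM, fmorphV, rmorphXn, rmorphN, rmorph_nat).
Qed.

(* Both families of the theorem at once: this is [d_kappa] for [k = 2 kappa] and
   [d'_kappa] for [k = 2 kappa + 1]. *)
Definition level_size (N k : nat) : nat := (N - 3 * k)./2.+1.

(** The vector of the even or odd family, according to the parity of k, without its scalar
    prefactor. *)
Definition sonine_state (R : realType) (T : 'I_8 -> 'M[R[i]]_3) (N k : nat) (x : R) : fock R :=
  \sum_(n < level_size N k)
    ((sonine R (3 * k + 3) n).[x])%:C%C *: (casimir2 T ^+ n * harmonic T k).

Lemma ket_evenE (R : realType) (T : 'I_8 -> 'M[R[i]]_3) (N kappa : nat) (E : R) :
  ket_even T N kappa E =
  ((2%:R * E) ^+ (3 * kappa) * expR (- E))%:C%C *: sonine_state T N (2 * kappa) (2%:R * E).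
Proof.
rewrite /ket_even /sonine_state big_mkord /level_size /d_even mulnA; congr (_ *: _).
apply: eq_bigr => n _; congr (_ *: _).
have -> : (2 * kappa = kappa.*2)%N by rewrite mul2n.
rewrite casimir2X_harmonic doubleK big_ord_recl harm_coef0 scale1r muln0 addn0 subn0 ketE.
congr (_ + _); rewrite big_add1 big_mkord; apply: eq_bigr => t _.
by rewrite Gamma_evenE ?ltn_ord // ketE -mul2n.
Qed.

Lemma ket_oddE (R : realType) (T : 'I_8 -> 'M[R[i]]_3) (N kappa : nat) (E : R) :
  ket_odd T N kappa E =
  ((2%:R * E) `^ ((3 * kappa)%:R + 3%:R / 2%:R) * expR (- E))%:C%C
  *: sonine_state T N (2 * kappa + 1) (2%:R * E).
Proof.
rewrite /ket_odd /sonine_state big_mkord /level_size /d_odd.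
have -> : (N - 6 * kappa - 3 = N - 3 * (2 * kappa + 1))%N by lia.
have -> : (6 * kappa + 6 = 3 * (2 * kappa + 1) + 3)%N by lia.
congr (_ *: _); apply: eq_bigr => n _; congr (_ *: _).
rewrite casimir2X_harmonic.
have -> : ((2 * kappa + 1)./2 = kappa)%N by lia.
rewrite big_ord_recl harm_coef0 scale1r muln0 addn0 subn0 ketE.
congr (_ + _); rewrite big_add1 big_mkord; apply: eq_bigr => t _.
rewrite Gamma_oddE ?ltn_ord // ketE.
have lt_t : (t < kappa)%N := ltn_ord t.
by have -> : (2 * kappa - 2 * t.+1 + 1 = 2 * kappa + 1 - 2 * t.+1)%N by lia.
Qed.

Section States.
Variables (R : realType) (T : 'I_8 -> 'M[R[i]]_3) (N : nat).
Hypothesis hT : su3_generators T.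

Let tr_gen A : \tr (T A) = 0. Proof. by case: hT. Qed.
Let tr_gen2 A B : \tr (T A *m T B) = (A == B)%:R / 2%:R. Proof. by case: hT. Qed.
Let roots k := rootsR (sonine R (3 * k + 3) (level_size N k)).

Lemma sum_inv_space (I : Type) (r : seq I) (P : pred I) (F : I -> fock R) :
  (forall i, P i -> inv_space T N (F i)) -> inv_space T N (\sum_(i <- r | P i) F i).
Proof.
move=> WF; elim/big_ind: _ => //; first exact: inv_space0.
by move=> f g; exact: inv_spaceD.
Qed.

Lemma lt_level_size (n k : nat) : (3 * k <= N)%N ->
  (n < level_size N k)%N = (2 * n + 3 * k <= N)%N.
Proof. by move=> le_k; rewrite /level_size; lia. Qed.

Lemma inv_space_casimir2X_harmonic (n k : nat) : (2 * n + 3 * k <= N)%N ->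
  inv_space T N (casimir2 T ^+ n * harmonic T k).
Proof.
move=> le_N; rewrite casimir2X_harmonic; apply: sum_inv_space => t _.
apply: inv_spaceZ; apply: inv_space_casimir => //.
by have := ltn_ord t; have := odd_double_half k; lia.
Qed.

Lemma inv_space_state (k : nat) (x : R) : (3 * k <= N)%N -> inv_space T N (sonine_state T N k x).
Proof.
move=> le_k; apply: sum_inv_space => n _; apply: inv_spaceZ.
by apply: inv_space_casimir2X_harmonic; rewrite -lt_level_size.
Qed.

(** Let d be half of N - 3k, rounded down. At a root one boundary term has coefficient 0; the other
    is a multiple of p2^(d+1) h_k, whose degree 2d + 2 + 3k exceeds N, so the cut discards it. *)
Lemma cut_ham_state (k : nat) (x : R) : (3 * k <= N)%N ->
  root (sonine R (3 * k + 3) (level_size N k)) x ->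
  cut_ham T N (sonine_state T N k x) = (x / 2%:R)%:C%C *: sonine_state T N k x.
Proof.
move=> le_k /eqP Ld0.
pose L n : R[i] := ((sonine R (3 * k + 3) n).[x])%:C%C.
have LM (c y : R) : (c * y)%:C%C = c%:C%C * y%:C%C by rewrite rmorphM.
have rec0 : (3 * k + 4)%:R * L 1 = ((3 * k + 4)%:R - x%:C%C) * L 0.
  have := congr1 (horner^~ x) (sonine_rec0 R (3 * k + 3)).
  rewrite hornerZ hornerM hornerD hornerN hornerX hornerC -addnS => e.
  by rewrite /L -(rmorph_nat (real_complex R)) -rmorphB -!rmorphM /= e.
have recS n : (n.+2 * (n + 3 * k + 5))%:R * L n.+2 =
    ((2 * n + 3 * k + 6)%:R - x%:C%C) * L n.+1 - L n.
  have := congr1 (horner^~ x) (sonine_rec R (3 * k + 3) n).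
  rewrite hornerZ !hornerD hornerM !hornerD !hornerN hornerX hornerC => e.
  rewrite /L -!(rmorph_nat (real_complex R)) -rmorphB -!rmorphM -rmorphB /=.
  have -> : (n + 3 * k + 5 = (n + (3 * k + 3)).+2)%N by lia.
  by rewrite e; have -> : (n.*2 + (3 * k + 3) + 3 = 2 * n + 3 * k + 6)%N by lia.
rewrite /cut_ham hamE // /sonine_state /level_size -/L.
rewrite (diff_ham_sonine_sum (x := x%:C%C) _ tr_gen tr_gen2 rec0 recS).
have -> : L (N - 3 * k)./2.+1 = 0 by rewrite /L Ld0.
rewrite mulr0 scale0r addr0 -scaleN1r cut_projD !cut_projZ.
rewrite (cut_proj_homog N (dhomogM (dhomogMn _ (casimir2_homog T)) (harmonic_homog T k))).
rewrite ifF; last by apply/negbTE; rewrite -ltnNge; lia.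
rewrite !scaler0 addr0 cut_proj_id; last by have [] := inv_space_state x le_k.
by rewrite rmorphM fmorphV rmorph_nat.
Qed.

Lemma size_level_roots (k : nat) : size (roots k) = level_size N k.
Proof. exact: size_rootsR_sonine. Qed.

Lemma mem_level_roots (k : nat) (x : R) :
  (x \in roots k) = root (sonine R (3 * k + 3) (level_size N k)) x.
Proof.
have p0 : sonine R (3 * k + 3) (level_size N k) != 0.
  by rewrite -size_poly_eq0 size_sonine.
by have := roots_on_rootsR p0 => /(_ x); rewrite inE /= => <-.
Qed.

(** The constant coefficient is a product of reciprocal factorials. *)
Lemma level_root_neq0 (k : nat) (x : R) : x \in roots k -> x != 0.
Proof.
rewrite mem_level_roots; apply: contraL => /eqP ->.
rewrite rootE horner_coef0 coef_sonine /inv_fact_sub leq0n expr0 !mul1r fact0 invr1 mul1r.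
by rewrite mulf_neq0 // invr_eq0 natr_fact_neq0.
Qed.

(** Collecting the coefficients of the independent p2^n h_k gives, at each level, the evaluation
    matrix at the roots applied to [c]; this matrix is invertible. *)
Lemma sonine_states_indep (c : nat -> R -> R[i]) :
  \sum_(k < (N %/ 3).+1) \sum_(x <- roots k) c k x *: sonine_state T N k x = 0 ->
  forall k x, (3 * k <= N)%N -> x \in roots k -> c k x = 0.
Proof.
move=> e.
(* Padding by 0 beyond the level gives all levels the same range n <= N, as the independence lemma
   requires. *)
pose b k n := if (n < level_size N k)%N then
  \sum_(x <- roots k) c k x * ((sonine R (3 * k + 3) n).[x])%:C%C else 0.
have b0 k n : (k < (N %/ 3).+1)%N -> (n < N.+1)%N -> b k n = 0.
  apply: (casimir_harmonic_indep tr_gen tr_gen2 (c := b)).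
  rewrite -[RHS]e; apply: eq_bigr => {}k _.
  rewrite /sonine_state; under [RHS]eq_bigr do rewrite scaler_sumr.
  rewrite [RHS]exchange_big /=.
  have le_size : (level_size N k <= N.+1)%N by rewrite /level_size; lia.
  rewrite [RHS](big_ord_widen _ (fun n => \sum_(x <- roots k) c k x *:
    (((sonine R (3 * k + 3) n).[x])%:C%C *: (casimir2 T ^+ n * harmonic T k))) le_size).
  rewrite [RHS]big_mkcond; apply: eq_bigr => {}n _ /=; rewrite /b.
  case: ifP => _; last by rewrite scale0r.
  by rewrite scaler_suml; apply: eq_bigr => x _; rewrite scalerA.
move=> k y le_k yr.
have [D [Dx _]] := graded_poly_dual (size_sonine R (3 * k + 3)) (uniq_roots _ _ _ : uniq (roots k)).
rewrite size_level_roots in Dx.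
transitivity (\sum_(n < level_size N k) b k n * (D n y)%:C%C); last first.
  apply: big1 => n _; rewrite b0 ?mul0r //; first by lia.
  by have := ltn_ord n; rewrite {2}/level_size; lia.
transitivity (\sum_(x <- roots k) c k x * ((x == y)%:R)%:C%C).
  rewrite (bigD1_seq y) ?uniq_roots //= eqxx mulr1 big1 ?addr0 // => x /negbTE ->.
  by rewrite mulr0.
rewrite big_seq; under eq_bigr => x xr do rewrite -(Dx x y xr yr) rmorph_sum mulr_sumr.
rewrite -big_seq exchange_big; apply: eq_bigr => n _ /=.
rewrite /b ltn_ord mulr_suml; apply: eq_bigr => x _.
by rewrite rmorphM mulrA.
Qed.

Lemma casimir2X_harmonic_state (n k : nat) : (2 * n + 3 * k <= N)%N ->
  exists c : R -> R[i],
    casimir2 T ^+ n * harmonic T k = \sum_(x <- roots k) c x *: sonine_state T N k x.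
Proof.
move=> le_N.
have [D [_ Dn]] := graded_poly_dual (size_sonine R (3 * k + 3)) (uniq_roots _ _ _ : uniq (roots k)).
rewrite size_level_roots in Dn.
have lt_n : (n < level_size N k)%N by rewrite lt_level_size //; lia.
exists (fun x => (D n x)%:C%C); rewrite /sonine_state.
under eq_bigr do rewrite scaler_sumr.
rewrite exchange_big /=.
transitivity (\sum_(m < level_size N k) ((n == m)%:R : R[i]) *: (casimir2 T ^+ m * harmonic T k)).
  rewrite (bigD1 (Ordinal lt_n)) //= eqxx scale1r big1 ?addr0 // => m.
  by rewrite -(inj_eq val_inj) eq_sym /= => /negbTE ->; rewrite scale0r.
apply: eq_bigr => m _; rewrite -(rmorph_nat (real_complex R)) -(Dn n m lt_n (ltn_ord m)).
by rewrite rmorph_sum scaler_suml; apply: eq_bigr => x _; rewrite rmorphM scalerA.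
Qed.

(** Strong induction on the power of p3: p2^j h_k is a combination of states, and it differs from
    p2^j p3^k by terms of the same degree with lower powers of p3. *)
Lemma sonine_states_span_ind (Q : fock R -> Prop) :
  Q 0 -> (forall p q, Q p -> Q q -> Q (p + q)) -> (forall c p, Q p -> Q (c *: p)) ->
  (forall k x, (3 * k <= N)%N -> x \in roots k -> Q (sonine_state T N k x)) ->
  forall f, inv_space T N f -> Q f.
Proof.
move=> Q0 QD QZ Qs; apply: (inv_space_span_ind hT) => // j k.
elim/ltn_ind: k j => k IHk j le_N.
have Qh : Q (casimir2 T ^+ j * harmonic T k).
  have [c ->] := casimir2X_harmonic_state le_N.
  rewrite big_seq; elim/big_ind: _ => // x xr; apply: QZ; apply: Qs => //; lia.
have := casimir2X_harmonic T j k.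
rewrite big_ord_recl harm_coef0 scale1r muln0 addn0 subn0 => /eqP; rewrite -subr_eq => /eqP <-.
apply: (QD) => //; rewrite -scaleN1r; apply: (QZ).
elim/big_ind: _ => // t _; apply: (QZ).
have := ltn_ord t; have := odd_double_half k => e lt_t.
by apply: IHk; rewrite /= /bump /=; lia.
Qed.

(** Independence applied to the indicator of a single pair of level and root. *)
Lemma sonine_state_neq0 (k : nat) (x : R) : (3 * k <= N)%N -> x \in roots k ->
  sonine_state T N k x <> 0.
Proof.
move=> le_k xr s0; have /eqP := oner_eq0 R[i]; apply.
have <- : ((k == k) && (x == x))%:R = 1 :> R[i] by rewrite !eqxx.
apply: (sonine_states_indep (c := fun k' x' => ((k' == k) && (x' == x))%:R)) => //.
apply: big1 => k' _; apply: big1 => x' _.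
by case: eqP => [->|_]; [case: eqP => [->|_]|]; rewrite ?s0 ?scaler0 ?scale0r.
Qed.

Lemma cut_hamZ (c : R[i]) (f : fock R) : cut_ham T N (c *: f) = c *: cut_ham T N f.
Proof. by rewrite /cut_ham !hamE // diff_hamZ cut_projZ. Qed.

Let scalerC (a b : R[i]) (v : fock R) : a *: (b *: v) = b *: (a *: v).
Proof. by rewrite !scalerA mulrC. Qed.

Lemma cut_eigenvector_state (c : R) (k : nat) (x : R) : (3 * k <= N)%N ->
  root (sonine R (3 * k + 3) (level_size N k)) x -> c != 0 ->
  cut_eigenvector T N (x / 2%:R) (c%:C%C *: sonine_state T N k x).
Proof.
move=> le_k rx c0; split.
- exact/inv_spaceZ/inv_space_state.
- move/eqP; rewrite scaler_eq0 fmorph_eq0 (negbTE c0) /= => /eqP.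
  by apply: sonine_state_neq0; rewrite ?mem_level_roots.
- by rewrite cut_hamZ cut_ham_state // scalerC.
Qed.

End States.

Lemma even_prefactor_neq0 (R : realType) (kappa : nat) (x : R) :
  x != 0 -> x ^+ (3 * kappa) * expR (- (x / 2%:R)) != 0.
Proof. by move=> x0; rewrite mulf_neq0 ?expf_neq0 // gt_eqF ?expR_gt0. Qed.

(** At a nonzero base [powR] unfolds to an exponential, so both factors are positive. *)
Lemma odd_prefactor_neq0 (R : realType) (kappa : nat) (x : R) :
  x != 0 -> x `^ ((3 * kappa)%:R + 3%:R / 2%:R) * expR (- (x / 2%:R)) != 0.
Proof.
by move=> x0; rewrite mulf_neq0 ?(gt_eqF (expR_gt0 _)) // /powR (negbTE x0) gt_eqF ?expR_gt0.
Qed.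

(** * Assembling the basis over all levels *)

Section Basis.
Variables (R : realType) (T : 'I_8 -> 'M[R[i]]_3) (N : nat).
Hypothesis hT : su3_generators T.
Let roots k := rootsR (sonine R (3 * k + 3) (level_size N k)).

(** Both prefactors in terms of the common level k, whose half is kappa in either parity. *)
Let prefactor (k : nat) (x : R) : R :=
  (if odd k then x `^ ((3 * k./2)%:R + 3%:R / 2%:R) else x ^+ (3 * k./2)) * expR (- (x / 2%:R)).

Let prefactor_neq0 k x : x != 0 -> prefactor k x != 0.
Proof.
by rewrite /prefactor; case: odd; [exact: odd_prefactor_neq0 | exact: even_prefactor_neq0].
Qed.

Let state (kx : nat * R) : fock R :=
  (prefactor kx.1 kx.2)%:C%C *: sonine_state T N kx.1 kx.2.

Let index := [seq (k, x) | k <- iota 0 (N %/ 3).+1, x <- roots k].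

Let mem_index k x : ((k, x) \in index) = (3 * k <= N)%N && (x \in roots k).
Proof.
apply/allpairsPdep/andP => [[k' [x' [+ xr]]]|[le_k xr]].
  by rewrite mem_iota => lt_k [-> ->]; split => //; lia.
by exists k, x; split=> //; rewrite mem_iota; lia.
Qed.

Let uniq_index : uniq index.
Proof.
apply: allpairs_uniq_dep => [|k _|]; rewrite ?iota_uniq //; first exact: uniq_roots.
by move=> [k x] [k' x'] _ _ /= [-> ->].
Qed.

Let even_index :=
  [seq ((2 * kappa)%N, x) | kappa <- [seq kappa <- iota 0 N.+1 | (6 * kappa <= N)%N],
    x <- rootsR (sonine R (6 * kappa + 3) (d_even N kappa))].

Let odd_index :=
  [seq ((2 * kappa + 1)%N, x) | kappa <- [seq kappa <- iota 0 N.+1 | (6 * kappa + 3 <= N)%N],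
    x <- rootsR (sonine R (6 * kappa + 6) (d_odd N kappa))].

Let even_roots kappa : rootsR (sonine R (6 * kappa + 3) (d_even N kappa)) = roots (2 * kappa).
Proof. by rewrite /roots /level_size mulnA. Qed.

Let odd_roots kappa : rootsR (sonine R (6 * kappa + 6) (d_odd N kappa)) = roots (2 * kappa + 1).
Proof.
rewrite /roots /level_size /d_odd.
have -> : (N - 6 * kappa - 3 = N - 3 * (2 * kappa + 1))%N by lia.
by have -> : (6 * kappa + 6 = 3 * (2 * kappa + 1) + 3)%N by lia.
Qed.

Let even_statesE : even_states T N = map state even_index.
Proof.
rewrite map_allpairs; apply: (congr1 flatten); apply: eq_map => kappa; apply: eq_map => x.
rewrite ket_evenE /state /prefactor /= mulrCA divff ?mulr1 ?pnatr_eq0 //.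
by rewrite mul2n odd_double doubleK.
Qed.

Let odd_statesE : odd_states T N = map state odd_index.
Proof.
rewrite map_allpairs; apply: (congr1 flatten); apply: eq_map => kappa; apply: eq_map => x.
rewrite ket_oddE /state /prefactor /= mulrCA divff ?mulr1 ?pnatr_eq0 //.
by rewrite mul2n addn1 /= odd_double uphalf_double.
Qed.

(** Every level k with 3k <= N is 2 kappa or 2 kappa + 1 for exactly one admissible kappa, so the
    two families list each pair of level and root once. *)
Let perm_index : perm_eq (even_index ++ odd_index) index.
Proof.
apply: uniq_perm => //.
  rewrite cat_uniq; apply/and3P; split.
  - apply: allpairs_uniq_dep => [|kappa _|]; rewrite ?filter_uniq ?iota_uniq //.
      exact: uniq_roots.
    by move=> [k x] [k' x'] _ _ /= [/eqP]; rewrite eqn_mul2l => /eqP -> ->.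
  - apply/hasPn => -[k x] /allpairsPdep[kappa [y [_ _ [-> _]]]].
    apply/negP => /allpairsPdep[kappa' [y' [_ _ []]]]; lia.
  - apply: allpairs_uniq_dep => [|kappa _|]; rewrite ?filter_uniq ?iota_uniq //.
      exact: uniq_roots.
    by move=> [k x] [k' x'] _ _ /= [/eqP]; rewrite eqn_add2r eqn_mul2l => /eqP -> ->.
move=> [k x]; rewrite mem_index mem_cat; apply/idP/andP.
  case/orP=> /allpairsPdep[kappa [y [+ + [-> ->]]]]; rewrite mem_filter => /andP[le_k _].
    by rewrite even_roots; split => //; lia.
  by rewrite odd_roots; split => //; lia.
move=> [le_k xr]; have := odd_double_half k; have [ok|ek] := boolP (odd k) => kE.
  apply/orP; right; apply/allpairsPdep; exists k./2, x.
  have kE' : k = (2 * k./2 + 1)%N by lia.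
  by rewrite odd_roots -kE' mem_filter mem_iota; split => //; lia.
apply/orP; left; apply/allpairsPdep; exists k./2, x.
have kE' : k = (2 * k./2)%N by lia.
by rewrite even_roots -kE' mem_filter mem_iota; split => //; lia.
Qed.

Let sum_index (G : nat * R -> fock R) :
  \sum_(kx <- even_index ++ odd_index) G kx =
  \sum_(k < (N %/ 3).+1) \sum_(x <- roots k) G (k : nat, x).
Proof.
rewrite (perm_big _ perm_index) big_allpairs_dep.
rewrite -(big_mkord predT (fun k => \sum_(x <- roots k) G (k, x))).
by rewrite /index_iota subn0.
Qed.

Lemma states_basis : is_basis (inv_space T N) (even_states T N ++ odd_states T N).
Proof.
have memE kx : kx \in even_index ++ odd_index -> (3 * kx.1 <= N)%N /\ kx.2 \in roots kx.1.
  by rewrite (perm_mem perm_index); case: kx => k x; rewrite mem_index => /andP.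
rewrite even_statesE odd_statesE -map_cat; apply: is_basis_map.
- by rewrite (perm_uniq perm_index).
- by move=> kx /memE[le_k _]; apply: inv_spaceZ; exact: inv_space_state.
- move=> c e kx /memE[le_k xr].
  have /eqP : c kx * (prefactor kx.1 kx.2)%:C%C = 0.
    case: kx le_k xr => k x le_k xr.
    apply: (sonine_states_indep hT (c := fun k x => c (k, x) * (prefactor k x)%:C%C)) xr => //.
    rewrite -[RHS]e sum_index; apply: eq_bigr => k' _; apply: eq_bigr => x' _.
    by rewrite scalerA.
  by rewrite mulf_eq0 fmorph_eq0 (negbTE (prefactor_neq0 _ (level_root_neq0 xr))) orbF => /eqP.
- apply: (sonine_states_span_ind hT).
  + by exists (fun=> 0); rewrite big1 // => kx _; rewrite scale0r.
  + move=> _ _ [c ->] [c' ->]; exists (fun kx => c kx + c' kx).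
    by rewrite -big_split; apply: eq_bigr => kx _; rewrite scalerDl.
  + move=> a _ [c ->]; exists (fun kx => a * c kx).
    by rewrite scaler_sumr; apply: eq_bigr => kx _; rewrite scalerA.
  (* A bare state is its own rescaled vector divided by the nonzero prefactor. *)
  move=> k x le_k xr; exists (fun kx => (kx == (k, x))%:R / (prefactor k x)%:C%C).
  rewrite (bigD1_seq (k, x)) /=; first last.
  + by rewrite (perm_uniq perm_index).
  + by rewrite (perm_mem perm_index) mem_index le_k.
  rewrite big1 ?addr0 => [|kx /negbTE ->]; last by rewrite mul0r scale0r.
  rewrite eqxx mul1r scalerA mulVf ?scale1r // fmorph_eq0.
  exact/prefactor_neq0/(level_root_neq0 xr).
Qed.

End Basis.

Theorem mainTheorem1 (R : realType) (T : 'I_8 -> 'M[R[i]]_3)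
    (hT : su3_generators T) (N : nat) :
  [/\ forall kappa : nat, (6 * kappa <= N)%N ->
        let L := sonine R (6 * kappa + 3) (d_even N kappa) in
        size (rootsR L) = d_even N kappa /\
        forall E : R, root L (2%:R * E) ->
          cut_eigenvector T N E (ket_even T N kappa E),
      forall kappa : nat, (6 * kappa + 3 <= N)%N ->
        let L := sonine R (6 * kappa + 6) (d_odd N kappa) in
        size (rootsR L) = d_odd N kappa /\
        forall E : R, root L (2%:R * E) ->
          cut_eigenvector T N E (ket_odd T N kappa E)
    & is_basis (inv_space T N) (even_states T N ++ odd_states T N)].
Proof.
(* The states are indexed by the root x = 2E, and their eigenvalue is x/2. *)
have half (E : R) : E = 2%:R * E / 2%:R by field.
split; last exact: states_basis.
- move=> kappa le_N; split; first exact: size_rootsR_sonine.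
  move=> E; have -> : sonine R (6 * kappa + 3) (d_even N kappa) =
      sonine R (3 * (2 * kappa) + 3) (level_size N (2 * kappa)).
    by rewrite /level_size mulnA.
  move=> rE; have E0 : 2%:R * E != 0.
    by apply: (level_root_neq0 (N := N) (k := 2 * kappa)); rewrite mem_level_roots.
  rewrite ket_evenE {1}(half E); apply: (cut_eigenvector_state hT) rE _; first by lia.
  by rewrite {2}(half E) even_prefactor_neq0.
- move=> kappa le_N; split; first exact: size_rootsR_sonine.
  move=> E; have -> : sonine R (6 * kappa + 6) (d_odd N kappa) =
      sonine R (3 * (2 * kappa + 1) + 3) (level_size N (2 * kappa + 1)).
    rewrite /level_size /d_odd.
    have -> : (N - 6 * kappa - 3 = N - 3 * (2 * kappa + 1))%N by lia.
    by have -> : (6 * kappa + 6 = 3 * (2 * kappa + 1) + 3)%N by lia.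
  move=> rE; have E0 : 2%:R * E != 0.
    by apply: (level_root_neq0 (N := N) (k := 2 * kappa + 1)); rewrite mem_level_roots.
  rewrite ket_oddE {1}(half E); apply: (cut_eigenvector_state hT) rE _; first by lia.
  by rewrite {2}(half E) odd_prefactor_neq0.
Qed.
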